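(* Let $R(f)=\frac12\|f\|^2$. There is a constant $\beta_{dual}>0$, depending only on $C^R$, $c_1$, $\eta$, $N_p$ (not on $d$, $\delta$, $\alpha_{acc}$, $\alpha$, $f^0$, $B_p$ or $\mathbb{P}^{xy}$), such that the following holds. Let $f^0\in\mathbb{R}^d\setminus\{0\}$, $\alpha_{acc}\in(0,1]$, $\alpha\in(0,1]$, $\delta\in(0,1/2)$, and set $\rho=\alpha_{acc}/\|f^0\|^2$. Let $D_p$ consist of $B_p$ i.i.d. samples from $\mathbb{P}^{xy}$. Let $\hat\alpha=\alpha-2\ln\big(1+\frac{c_1C^R}{B_p(\rho+2\eta N_p)}\big)$, let $\epsilon$ be drawn independently of $D_p$ with density proportional to $e^{-(\hat\alpha/2)\|\epsilon\|}$, and let $$f^*_p=\arg\min_f\Big(Z_p(f\mid D_p)+\frac{C^R}{B_p}\epsilon^Tf\Big).$$ If $$B_p>\beta_{dual}\max\Big(\frac{\|f^0\|\,d\ln(d/\delta)}{\alpha_{acc}\alpha},\ \frac{C^Rc_1\|f^0\|^2}{\alpha_{acc}\alpha},\ \frac{C^R\|f^0\|^2\ln(1/\delta)}{\alpha_{acc}^2}\Big),$$ then $\hat\alpha>0$ and $\mathbb{P}\big(\hat C(f^*_p)\le\hat C(f^0)+\alpha_{acc}\big)\ge1-2\delta$, the probability being over $D_p$ and $\epsilon$.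
   Context: $\mathbb{P}^{xy}$ is a probability distribution on $\{x\in\mathbb{R}^d:\|x\|\le1\}\times\{-1,1\}$. The loss $\mathcal{L}:\mathbb{R}\to\mathbb{R}$ is strictly convex and twice continuously differentiable with $|\mathcal{L}'|\le1$ and $|\mathcal{L}''|\le c_1$. $C^R>0$, $\eta>0$, $N_p\ge1$ an integer. $Z_p(f\mid D_p)=\frac{C^R}{B_p}\sum_{j=1}^{B_p}\mathcal{L}(y_jf^Tx_j)+\rho R(f)$ for $D_p=((x_j,y_j))_{j=1}^{B_p}$. The expected loss is $\hat C(f)=C^R\,\mathbb{E}_{(x,y)\sim\mathbb{P}^{xy}}[\mathcal{L}(yf^Tx)]$. *)

(* Defs.v *)
From HB Require Import structures.
From mathcomp Require Import all_boot all_order all_algebra.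
From mathcomp Require Import all_classical all_reals all_analysis.
Set Implicit Arguments. Unset Strict Implicit. Unset Printing Implicit Defensive.
Import Order.TTheory GRing.Theory Num.Theory.
Import numFieldNormedType.Exports.
Local Open Scope classical_set_scope.
Local Open Scope ring_scope.

(* Vectors of R^d are d-tuples (which carry the product Borel sigma-algebra
   generated by the coordinate projections in mathcomp-analysis). *)
Section Defs.
Variable R : realType.

Definition dotv (d : nat) (u v : d.-tuple R) : R :=
  \sum_(i < d) tnth u i * tnth v i.
Definition enorm (d : nat) (v : d.-tuple R) : R := Num.sqrt (dotv v v).

Definition zerov (d : nat) : d.-tuple R := [tuple (0 : R) | _ < d].

(* Iterated Lebesgue integral over R^n (coordinates 0..n-1) of a function of
   x : nat -> R; for nonnegative measurable integrands this is the integral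
   w.r.t. the n-dimensional Lebesgue measure (Tonelli). *)
Fixpoint lebint (n : nat) (g : (nat -> R) -> \bar R) : \bar R :=
  if n is m.+1 then
    (\int[@lebesgue_measure R]_t
        lebint m (fun x => g (fun k => if k == m then t else x k)))%E
  else g (fun _ => 0).

Definition lebint_vec (d : nat) (g : d.-tuple R -> \bar R) : \bar R :=
  lebint d (fun x => g [tuple x (nat_of_ord i) | i < d]).

Definition regul (d : nat) (f : d.-tuple R) : R := 2^-1 * enorm f ^+ 2.

Definition admissible_loss (c1 : R) (L : R -> R) : Prop :=
  (forall a b t : R, a != b -> 0 < t -> t < 1 ->
         L (t * a + (1 - t) * b) < t * L a + (1 - t) * L b) /\
  [/\ (forall t : R, derivable L t 1),
      (forall t : R, derivable (derive1 L) t 1),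
      continuous (derive1 (derive1 L)),
      (forall t : R, `|derive1 L t| <= 1) &
      (forall t : R, `|derive1 (derive1 L) t| <= c1)].

Definition Zp_obj (d B : nat) (CR rho : R) (L : R -> R)
    (D : 'I_B -> (d.-tuple R * R)) (f : d.-tuple R) : R :=
  CR / B%:R * (\sum_(j < B) L ((D j).2 * dotv f (D j).1)) + rho * regul f.

Definition Chat (d : nat) (CR : R) (L : R -> R)
    (Pxy : probability (d.-tuple R * R)%type R) (f : d.-tuple R) : R :=
  CR * fine (\int[Pxy]_z (L (z.2 * dotv f z.1))%:E)%E.

Definition is_argmin (d : nat) (J : d.-tuple R -> R) (f : d.-tuple R) : Prop :=
  forall g, J f <= J g.

End Defs.

(* Main.v *)
Require Import Defs.
From HB Require Import structures.
From mathcomp Require Import all_boot all_order all_algebra.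
From mathcomp Require Import all_classical all_reals all_analysis.
From mathcomp Require Import measurable_realfun ring lra.
Import Order.TTheory GRing.Theory Num.Theory.
Import numFieldNormedType.Exports.
Set Implicit Arguments. Unset Strict Implicit. Unset Printing Implicit Defensive.
Local Open Scope classical_set_scope.
Local Open Scope ring_scope.

(* The samples are first quantized: up to an arbitrarily small error tau in the
   vectors y x, they take finitely many values, so the population and the
   empirical objectives become finite sums and the law of the sample a product
   of finite weights. Let c minimize the regularized quantized population
   objective. On the ball of radius |f0| around c, the deviation between
   empirical and population excess losses is bounded with probability 1 - delta
   by a dimension-free symmetrization and contraction argument carried out
   directly on exponential moments. The noise satisfies |eps| <= t with
   probability 1 - delta by a Chernoff bound. Since rho = aacc / |f0|^2, this
   radius is exactly the scale where strong convexity (rho |f0|^2 / 4 = aacc / 4)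
   beats both deviations (aacc / 8 together), so the perturbed empirical minimizer
   lies in that ball, and its risk exceeds that of f0 by less than
   rho |f0|^2 / 2 + aacc / 2 = aacc. *)

(** Quantization buys finiteness: the supremum over a ball and the expectation over [B] samples
    become finite maxima and sums, so symmetrization needs neither measurable suprema nor product
    integrals. It costs nothing, because no bound involves the number of cells. Covering the ball
    would bring the dimension into the deviation bound, whereas [d] enters the condition on [B] only
    through the noise; hence the contraction argument. The a priori radius of a minimizer is of
    order [CR / rho], that is CR |f0|^2 / aacc, and uniform deviation at that radius would call for
    [B] of order |f0|^4 / aacc^4; hence the localization around [c]. The a priori radius enters only
    in the choice of [tau]. *)

Section Vectors.
Context {R : realType} {d : nat}.
Implicit Types u v w : d.-tuple R.

(** One operation serves as difference, midpoint, convex combination and, with [b = 0], scaling, so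
    the same two bilinearity lemmas expand every inner product. *)
Definition lcomb (a : R) u (b : R) v : d.-tuple R :=
  [tuple a * tnth u i + b * tnth v i | i < d].

Lemma dotvC u v : dotv u v = dotv v u.
Proof. by apply: eq_bigr => i _; rewrite mulrC. Qed.

Lemma dotv_lcomb a u b v w : dotv (lcomb a u b v) w = a * dotv u w + b * dotv v w.
Proof.
rewrite /dotv !mulr_sumr -big_split/=; apply: eq_bigr => i _.
by rewrite tnth_mktuple mulrDl !mulrA.
Qed.

Lemma dotv_lcombr a u b v w : dotv w (lcomb a u b v) = a * dotv w u + b * dotv w v.
Proof. by rewrite dotvC dotv_lcomb !(dotvC w). Qed.

Lemma dotvv_ge0 u : 0 <= dotv u u.
Proof. by apply: sumr_ge0 => i _; rewrite -expr2 sqr_ge0. Qed.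

Lemma enorm_ge0 u : 0 <= enorm u.
Proof. exact: sqrtr_ge0. Qed.

Lemma enorm_sqr u : enorm u ^+ 2 = dotv u u.
Proof. by rewrite sqr_sqrtr// dotvv_ge0. Qed.

Lemma dotv0 u : dotv u (zerov R d) = 0.
Proof. by rewrite /dotv big1// => i _; rewrite tnth_mktuple mulr0. Qed.

Lemma enorm0 : enorm (zerov R d) = 0.
Proof. by rewrite /enorm dotv0 sqrtr0. Qed.

Lemma enorm_eq0 u : enorm u = 0 -> u = zerov R d.
Proof.
move=> u0; have : dotv u u = 0 by rewrite -enorm_sqr u0 expr0n.
move=> /eqP; rewrite psumr_eq0 => [/allP h|i _]; last by rewrite -expr2 sqr_ge0.
apply: eq_from_tnth => i; rewrite tnth_mktuple.
by have := h i (mem_index_enum _); rewrite /= mulf_eq0 orbb => /eqP.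
Qed.

Lemma enorm_gt0 u : u != zerov R d -> 0 < enorm u.
Proof.
move=> u0; rewrite lt0r enorm_ge0 andbT; apply: contra u0 => /eqP u0.
by apply/eqP/enorm_eq0.
Qed.

(** Expand the square of (v.v) u - (u.v) v and divide by v.v. *)
Lemma cauchy_schwarz u v : `|dotv u v| <= enorm u * enorm v.
Proof.
have [v0|v0] := eqVneq (enorm v) 0.
  by rewrite (enorm_eq0 v0) dotv0 normr0 mulr_ge0// enorm_ge0.
rewrite -(@ler_pXn2r _ 2)// ?nnegrE ?mulr_ge0 ?enorm_ge0//.
rewrite -normrX ger0_norm ?sqr_ge0// exprMn !enorm_sqr.
have v2 : 0 < dotv v v by rewrite -enorm_sqr exprn_gt0// lt0r v0 enorm_ge0.
have := dotvv_ge0 (lcomb (dotv v v) u (- dotv u v) v).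
rewrite dotv_lcomb !dotv_lcombr (dotvC v u) => h.
have {h} : 0 <= dotv v v * (dotv u u * dotv v v - dotv u v ^+ 2) by nra.
by rewrite pmulr_rge0// subr_ge0.
Qed.

Lemma ler_dotv u v : dotv u v <= enorm u * enorm v.
Proof. exact: le_trans (ler_norm _) (cauchy_schwarz _ _). Qed.

Lemma enorm_lcomb a u b v : enorm (lcomb a u b v) <= `|a| * enorm u + `|b| * enorm v.
Proof.
rewrite -(@ler_pXn2r _ 2)// ?nnegrE ?addr_ge0 ?mulr_ge0 ?enorm_ge0//.
rewrite enorm_sqr dotv_lcomb !dotv_lcombr (dotvC v u) -!enorm_sqr.
have h : (a * b) * dotv u v <= (`|a| * `|b|) * (enorm u * enorm v).
  apply: le_trans (ler_norm _) _.
  by rewrite !normrM ler_wpM2l ?mulr_ge0// cauchy_schwarz.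
have ha : `|a| ^+ 2 = a ^+ 2 by rewrite real_normK// num_real.
have hb : `|b| ^+ 2 = b ^+ 2 by rewrite real_normK// num_real.
rewrite [leRHS]sqrrD !exprMn ha hb; nra.
Qed.

Lemma enormZ a u : enorm (lcomb a u 0 u) = `|a| * enorm u.
Proof.
rewrite /enorm dotv_lcomb !dotv_lcombr !mul0r !addr0 mulrA -expr2.
by rewrite sqrtrM ?sqr_ge0// sqrtr_sqr.
Qed.

Lemma enorm_le_sum u : enorm u <= \sum_(i < d) `|tnth u i|.
Proof.
rewrite -(@ler_pXn2r _ 2)// ?nnegrE ?enorm_ge0 ?sumr_ge0//.
rewrite enorm_sqr /dotv expr2 mulr_suml; apply: ler_sum => i _.
apply: le_trans (ler_norm _) _; rewrite normrM ler_wpM2l//.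
by rewrite (bigD1 i)//= lerDl sumr_ge0.
Qed.

Lemma ler_tnth_enorm u i : `|tnth u i| <= enorm u.
Proof.
rewrite -sqrtr_sqr; apply: ler_wsqrtr.
by rewrite /dotv (bigD1 i)//= -expr2 lerDl sumr_ge0// => j _; rewrite -expr2 sqr_ge0.
Qed.

End Vectors.

(** * Two-point contraction for exponentials, and a subgaussian bound *)

Section Contraction.
Context {R : realType}.
Implicit Types a b p q u w : R.

(** Convexity of exp: raising the exponent with the larger base [p] gains more than lowering the
    other one loses. After factoring out exp (w - u) - 1 this is exp (- w) <= exp u. *)
Lemma expR_sum_mono p q u w : q <= p -> `|u| <= w ->
  expR (p + u) + expR (q - u) <= expR (p + w) + expR (q - w).
Proof.
move=> qp /ler_normlP[uw1 uw2].
have e1 : expR q <= expR p by rewrite ler_expR.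
have e2 : expR u <= expR w by rewrite ler_expR.
have e3 : expR (- w) <= expR (- u) by rewrite ler_expR; lra.
have e4 : expR (- u) - expR (- w) <= expR w - expR u.
  have -> : expR (- u) = expR (w - u) * expR (- w) by rewrite -expRD; congr expR; lra.
  have -> : expR w = expR (w - u) * expR u by rewrite -expRD; congr expR; lra.
  have h : 1 <= expR (w - u) by rewrite -expR0 ler_expR; lra.
  have h2 : expR (- w) <= expR u by rewrite ler_expR; lra.
  nra.
rewrite !expRD; have := expR_gt0 q; nra.
Qed.

(** Two-index core of the contraction principle: one index is used for the sign +, the other for the
    sign -. The maxima appear because the linear side may have to pick its index anew for each sign.
    Flipping the signs of [s] and [s'] together swaps the maxima, whence the reduction to
    [0 <= s]. *)
Lemma expR_contraction a b (f f' s s' : R) :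
  `|f| <= `|s| -> `|f'| <= `|s'| -> `|f - f'| <= `|s - s'| ->
  expR (a + f) + expR (b - f') <=
    Num.max (expR (a + s)) (expR (b + s')) + Num.max (expR (a - s)) (expR (b - s')).
Proof.
wlog s0 : s s' / 0 <= s.
  move=> h; have [s0|/ltW s0] := leP 0 s; first exact: h.
  move=> h1 h2 h3.
  have := h (- s) (- s'); rewrite oppr_ge0 !normrN !opprK => /(_ s0 h1 h2).
  by rewrite [- s + s']addrC [`|s' - s|]distrC => /(_ h3) /le_trans; apply; rewrite addrC.
rewrite (ger0_norm s0) => h1 h2 h3.
set A := Num.max _ _; set B := Num.max _ _.
have A1 : expR (a + s) <= A by rewrite /A le_max lexx.
have A2 : expR (b + s') <= A by rewrite /A le_max lexx orbT.
have B1 : expR (a - s) <= B by rewrite /B le_max lexx.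
have B2 : expR (b - s') <= B by rewrite /B le_max lexx orbT.
(* If [s] and [s'] have opposite signs, the two terms are bounded separately. *)
have [s'0|/ltW s'0] := leP 0 s'; last first.
  move: h1 h2; rewrite (ler0_norm s'0) => /ler_normlP[h1 h1'] /ler_normlP[h2 h2'].
  apply: lerD; apply: le_trans (_ : _ <= expR _) _; [|exact: A1| |exact: B2];
  rewrite ler_expR; lra.
(* With equal signs, the distance hypothesis rewrites one exponent with the other's increment. Then
   [expR_sum_mono] applies either to the two distinct bases or, when their order is wrong, to one
   base used twice; the second use is where a maximum picks the same index for both signs. *)
have [ss|/ltW ss] := leP s' s.
- move: h2 h3; rewrite (ger0_norm s'0) (ger0_norm (_ : 0 <= s - s')) ?subr_ge0//.
  move=> h2 /ler_normlP[h3 h3'].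
  have l : expR (a + f) <= expR ((a + s - s') + f') by rewrite ler_expR; lra.
  have [pq|/ltW pq] := leP b (a + s - s').
    have := expR_sum_mono pq h2.
    rewrite subrK; lra.
  have l' : expR ((a + s - s') + f') <= expR (b + f') by rewrite ler_expR; lra.
  have := expR_sum_mono (lexx b) h2; lra.
- move: h2 h3; rewrite (ger0_norm s'0) (ler0_norm (_ : s - s' <= 0)) ?subr_le0//.
  move=> h2 /ler_normlP[h3 h3'].
  have l : expR (b - f') <= expR ((b + s' - s) - f) by rewrite ler_expR; lra.
  have [pq|/ltW pq] := leP (b + s' - s) a.
    have l' : expR ((b + s' - s) - f) <= expR (a - f) by rewrite ler_expR; lra.
    have := expR_sum_mono (lexx a) h1; lra.
  have h1' : `|- f| <= s by rewrite normrN.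
  have := expR_sum_mono pq h1'; rewrite opprK subrK; lra.
Qed.

(** The sharp exponent is y^2 / 2; the slack allows an elementary proof, since for y^2 > 1/2 already
    |y| <= 2 y^2. *)
Lemma cosh_le (y : R) : expR y + expR (- y) <= 2 * expR (2 * y ^+ 2).
Proof.
have [y1|y1] := leP (y ^+ 2) 2^-1; last first.
  have h : `|y| <= 2 * y ^+ 2.
    rewrite -(real_normK (num_real y)) in y1 *.
    by have := normr_ge0 y; nra.
  have := ler_norm y; have := ler_norm (- y); rewrite normrN => h1 h2.
  have : expR y <= expR (2 * y ^+ 2) by rewrite ler_expR; lra.
  have : expR (- y) <= expR (2 * y ^+ 2) by rewrite ler_expR; lra.
  lra.
have e1 := expR_ge1Dx y; have e2 := expR_ge1Dx (- y).
have p1 := expR_gt0 y; have p2 := expR_gt0 (- y).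
have e3 := expRxMexpNx_1 y.
have e4 := expR_ge1Dx (2 * y ^+ 2).
(* expR y <= 1/(1-y), so the sum is at most 2/(1-y^2) <= 2(1+2y^2) *)
have h1 : expR y * (1 - y) <= 1 by nra.
have h2 : expR (- y) * (1 + y) <= 1 by nra.
have yl : -1 < y < 1 by apply/andP; split; nra.
move/andP: yl => [yl yr].
have h3 : (expR y + expR (- y)) * (1 - y ^+ 2) <= 2 by nra.
have h4 : (expR y + expR (- y)) * (1 - y ^+ 2) <= (2 * (1 + 2 * y ^+ 2)) * (1 - y ^+ 2).
  apply: le_trans h3 _; have := sqr_ge0 y; nra.
rewrite ler_pM2r in h4; [lra|lra].
Qed.

End Contraction.

(** * Symmetrization and contraction, one sample at a time *)

Section Symmetrization.
Context {R : realType} {I Q : finType} (p : Q -> R) (h s : Q -> I -> R).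
Hypothesis p_ge0 : forall q, 0 <= p q.
Hypothesis p_sum : \sum_q p q = 1.
Hypothesis h_contr0 : forall q i, `|h q i| <= `|s q i|.
Hypothesis h_contr : forall q i k, `|h q i - h q k| <= `|s q i - s q k|.
Implicit Types A : I -> R.

(* The base value 0 is harmless since every term is positive. *)
Definition expmax A : R := \big[Num.max/0]_i expR (A i).

Lemma expmax_ge A i : expR (A i) <= expmax A.
Proof. by rewrite /expmax (bigD1 i)//= le_max lexx. Qed.

Lemma expmax_ge0 A : 0 <= expmax A.
Proof. by rewrite /expmax; elim/big_ind : _ => // x y x0 y0; rewrite le_max x0. Qed.

Lemma expmax_le A c : 0 <= c -> (forall i, expR (A i) <= c) -> expmax A <= c.
Proof.
move=> c0 Ac; rewrite /expmax; elim/big_ind : _ => // x y xc yc.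
by rewrite ge_max xc.
Qed.

(** The two maxima on the left are independent, so it suffices to bound each pair of terms, with
    index [i] for + and [k] for -; that is [expR_contraction]. *)
Lemma expmax_contraction A q :
  expmax (fun i => A i + 2 * h q i) + expmax (fun i => A i - 2 * h q i) <=
  expmax (fun i => A i + 2 * s q i) + expmax (fun i => A i - 2 * s q i).
Proof.
set S := leRHS.
have S0 : 0 <= S by rewrite addr_ge0 ?expmax_ge0.
have H i k : expR (A i + 2 * h q i) + expR (A k - 2 * h q k) <= S.
  apply: le_trans (@expR_contraction _ (A i) (A k) _ _ (2 * s q i) (2 * s q k) _ _ _) _.
  - by rewrite !normrM ler_wpM2l.
  - by rewrite !normrM ler_wpM2l.
  - by rewrite -!mulrBr !normrM ler_wpM2l.
  by apply: lerD; rewrite ge_max !(expmax_ge (fun i => A i + _), expmax_ge (fun i => A i - _)).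
rewrite -lerBrDr; apply: expmax_le => [|i].
  rewrite subr_ge0; apply: expmax_le => // i.
  by apply: le_trans (H i i); rewrite lerDr expR_ge0.
rewrite lerBrDr -lerBrDl; apply: expmax_le => [|k].
  by rewrite subr_ge0; apply: le_trans (H i i); rewrite lerDl expR_ge0.
by rewrite lerBrDl H.
Qed.

Definition dmean i := \sum_q p q * h q i.

(* [iter n dev_step F] is the expectation of [F] shifted by a sum of n
   independent centred losses; [sym_step] replaces the centred loss by the
   linear form [s] with an independent random sign and a factor 2. *)
Definition dev_step (F : (I -> R) -> R) A : R :=
  \sum_q p q * F (fun i => A i + (dmean i - h q i)).

Definition sym_step (F : (I -> R) -> R) A : R :=
  \sum_q p q * ((F (fun i => A i + 2 * s q i) + F (fun i => A i - 2 * s q i)) / 2).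

(** Jensen's inequality, from the tangent of exp at the mean. *)
Lemma expR_mean (T : finType) (w x : T -> R) : (forall t, 0 <= w t) -> \sum_t w t = 1 ->
  expR (\sum_t w t * x t) <= \sum_t w t * expR (x t).
Proof.
move=> w0 w1; set m := \sum_t _.
have -> : expR m = \sum_t w t * (expR m * (1 + (x t - m))).
  under eq_bigr do rewrite mulrCA mulrDr mulr1 mulrBr.
  by rewrite -mulr_sumr big_split/= sumrB -mulr_suml w1 -/m mul1r subrr addr0 mulr1.
apply: ler_sum => t _; rewrite ler_wpM2l//.
have -> : expR (x t) = expR m * expR (x t - m) by rewrite -expRD addrC subrK.
by rewrite ler_wpM2l ?expR_ge0// expR_ge1Dx.
Qed.

(** Jensen replaces the mean by an independent copy [q']. Writing the difference of losses as the
    half-sum of 2 h(q') and -2 h(q) and using convexity again decouples [q'] from [q]: each half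
    then involves a single sample with one sign, at the price of the factor 2. Contraction
    finishes. *)
Lemma dev_step_expmax A : dev_step expmax A <= sym_step expmax A.
Proof.
apply: (@le_trans _ _ (\sum_q p q * \sum_q' p q' *
   ((expmax (fun i => A i + 2 * h q' i) + expmax (fun i => A i - 2 * h q i)) / 2))).
  apply: ler_sum => q _; rewrite ler_wpM2l//.
  apply: expmax_le => [|i].
    by apply: sumr_ge0 => q' _; rewrite mulr_ge0// divr_ge0// addr_ge0 ?expmax_ge0.
  have -> : A i + (dmean i - h q i) = \sum_q' p q' * (A i + (h q' i - h q i)).
    under [RHS]eq_bigr do rewrite !mulrDr.
    by rewrite !big_split/= -!mulr_suml p_sum !mul1r.
  apply: le_trans (expR_mean _ p_ge0 p_sum) _.
  apply: ler_sum => q' _; rewrite ler_wpM2l//.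
  have -> : A i + (h q' i - h q i) = 2^-1 * (A i + 2 * h q' i) + 2^-1 * (A i - 2 * h q i).
    by field.
  have half : (2^-1 : R) + 2^-1 = 1 by lra.
  pose x (b : bool) := if b then A i + 2 * h q' i else A i - 2 * h q i.
  have := @expR_mean _ (fun=> 2^-1) x; rewrite !big_bool/= => H.
  apply: le_trans (H _ half) _ => [_|]; first by rewrite invr_ge0.
  clear H x.
  have := expmax_ge (fun i => A i + 2 * h q' i) i.
  have := expmax_ge (fun i => A i - 2 * h q i) i.
  lra.
have -> : (\sum_q p q * \sum_q' p q' *
   ((expmax (fun i => A i + 2 * h q' i) + expmax (fun i => A i - 2 * h q i)) / 2)) =
  \sum_q p q * ((expmax (fun i => A i + 2 * h q i) + expmax (fun i => A i - 2 * h q i)) / 2).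
  under eq_bigr => q _.
    under eq_bigr do rewrite mulrDl mulrDr.
    rewrite big_split/= -mulr_suml p_sum mul1r mulrDr.
    over.
  rewrite big_split/= -mulr_suml p_sum mul1r -big_split/=.
  by apply: eq_bigr => q _; rewrite mulrDl mulrDr.
by apply: ler_sum => q _; rewrite ler_wpM2l// ler_pM2r ?invr_gt0// expmax_contraction.
Qed.

Lemma dev_step_le F G : (forall A, F A <= G A) -> forall A, dev_step F A <= dev_step G A.
Proof. by move=> FG A; apply: ler_sum => q _; rewrite ler_wpM2l. Qed.

Lemma sym_step_le F G : (forall A, F A <= G A) -> forall A, sym_step F A <= sym_step G A.
Proof.
by move=> FG A; apply: ler_sum => q _; rewrite ler_wpM2l// ler_pM2r ?invr_gt0// lerD.
Qed.

(* Both steps are averages of translations, hence commute; this lets the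
   centred losses be symmetrized one sample at a time. *)
Lemma dev_sym_stepC F A : dev_step (sym_step F) A = sym_step (dev_step F) A.
Proof.
rewrite /dev_step /sym_step.
under eq_bigr do rewrite mulr_sumr.
rewrite exchange_big/=; apply: eq_bigr => q _.
rewrite -big_split/= mulr_suml mulr_sumr; apply: eq_bigr => q' _.
rewrite -mulrDr -[in RHS]mulrA [RHS]mulrCA.
by congr (_ * (_ * (_ / _))); congr (F _ + F _); apply/funext => i; rewrite addrAC.
Qed.

(** [dev_step_expmax] is available only at [expmax] itself, so only the innermost step can be
    exchanged; the new [sym_step] is then commuted to the outside, and the induction hypothesis
    handles the rest. *)
Lemma iter_dev_sym n A : iter n dev_step expmax A <= iter n sym_step expmax A.
Proof.
have comm : forall k B, iter k dev_step (sym_step expmax) B = sym_step (iter k dev_step expmax) B.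
  elim=> [//|k IH] B /=; rewrite -dev_sym_stepC.
  by congr dev_step; apply/funext.
elim: n A => [//|n IH] A; rewrite iterSr.
apply: (@le_trans _ _ (iter n dev_step (sym_step expmax) A)).
  elim: n A {IH} => [|n IH] A /=; first exact: dev_step_expmax.
  exact: dev_step_le.
by rewrite comm /=; apply: sym_step_le.
Qed.

Lemma iter_dev_stepE n F A :
  \sum_(v : {ffun 'I_n -> Q}) (\prod_j p (v j)) *
      F (fun i => A i + \sum_j (dmean i - h (v j) i)) = iter n dev_step F A.
Proof.
elim: n A => [|n IH] A.
  rewrite (big_pred1 [ffun j : 'I_0 => match notF (valP j) with end]) /=; last first.
    by move=> v /=; apply/esym/eqP/ffunP => -[].
  by rewrite big_ord0 mul1r; congr F; apply/funext => i; rewrite big_ord0 addr0.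
(* This bijection splits off the first sample, the one averaged by the outermost [dev_step]. *)
pose cons (x : Q * {ffun 'I_n -> Q}) : {ffun 'I_n.+1 -> Q} :=
  [ffun j => if unlift ord0 j is Some k then x.2 k else x.1].
pose uncons (v : {ffun 'I_n.+1 -> Q}) : Q * {ffun 'I_n -> Q} :=
  (v ord0, [ffun k => v (lift ord0 k)]).
have consK : cancel cons uncons.
  move=> [q v]; rewrite /uncons /cons; congr pair; first by rewrite ffunE unlift_none.
  by apply/ffunP => k; rewrite !ffunE liftK.
have unconsK : cancel uncons cons.
  move=> v; apply/ffunP => j; rewrite ffunE.
  by case: unliftP => [k ->|->] //=; rewrite ffunE.
rewrite (reindex cons)/=; last by apply: onW_bij; exists uncons.
rewrite -(pair_bigA _ (fun q v => (\prod_j p (cons (q, v) j)) *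
   F (fun i => A i + \sum_j (dmean i - h (cons (q, v) j) i))))/=.
apply: eq_bigr => q _; rewrite -IH mulr_sumr; apply: eq_bigr => v _.
have c0 : cons (q, v) ord0 = q by rewrite ffunE unlift_none.
have cS k : cons (q, v) (lift ord0 k) = v k by rewrite ffunE liftK.
rewrite big_ord_recl c0 mulrA; congr (_ * _ * F _).
  by apply: eq_bigr => k _; rewrite cS.
apply/funext => i; rewrite big_ord_recl c0 addrA; congr (_ + _).
by apply: eq_bigr => k _; rewrite cS.
Qed.

End Symmetrization.

(** * Exponential moments of norms of random signed sums *)

Section Potential.
Context {R : realType} {d : nat}.
Implicit Types (u x w : d.-tuple R) (mu m : R).

Lemma sqrt_pm_le (a b : R) : 1 <= a -> `|b| <= a -> Num.sqrt (a ^+ 2 + 2 * b) <= a + b / a.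
Proof.
move=> a1 ba; have a0 : 0 < a by lra.
have : `|b / a| <= 1 by rewrite normrM normfV (gtr0_norm a0) ler_pdivrMr// mul1r.
move=> /ler_normlP[h1 h2].
have -> : a + b / a = Num.sqrt ((a + b / a) ^+ 2) by rewrite sqrtr_sqr ger0_norm//; lra.
apply: ler_wsqrtr; rewrite sqrrD -addrA lerD2l.
rewrite mulrCA mulfV ?gt_eqF// mulr1 -[b *+ 2]mulr_natl lerDl; exact: sqr_ge0.
Qed.

(* A dimension-free bound on the norm of a random signed sum: iterate
   sqrt (a^2 +- 2 b) <= a +- b / a together with cosh y <= exp (2 y^2). *)
Lemma expR_sqrt_step m mu u x : 0 <= m -> 0 <= mu -> enorm x <= 1 ->
  (expR (mu * Num.sqrt (m + enorm (lcomb 1 u 1 x) ^+ 2)) +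
   expR (mu * Num.sqrt (m + enorm (lcomb 1 u (-1) x) ^+ 2))) / 2 <=
  expR (2 * mu ^+ 2 + mu * Num.sqrt (m + 1 + enorm u ^+ 2)).
Proof.
move=> m0 mu0 x1; set a := Num.sqrt (m + 1 + _).
have u0 := enorm_ge0 u; have x0 := enorm_ge0 x.
have a2 : a ^+ 2 = m + 1 + enorm u ^+ 2 by rewrite sqr_sqrtr//; nra.
have a1 : 1 <= a.
  have -> : 1 = Num.sqrt 1 :> R by rewrite sqrtr1.
  by apply: ler_wsqrtr; nra.
have ua : enorm u <= a.
  have -> : enorm u = Num.sqrt (enorm u ^+ 2) by rewrite sqrtr_sqr ger0_norm.
  by apply: ler_wsqrtr; nra.
have ba : `|dotv u x| <= a.
  by apply: le_trans (cauchy_schwarz _ _) _; nra.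
have H (e : R) : e ^+ 2 = 1 -> `|e * dotv u x| <= a ->
    expR (mu * Num.sqrt (m + enorm (lcomb 1 u e x) ^+ 2)) <=
    expR (mu * a) * expR (e * (mu * dotv u x / a)).
  move=> e2 eb; rewrite -expRD ler_expR.
  have -> : mu * a + e * (mu * dotv u x / a) = mu * (a + (e * dotv u x) / a).
    by rewrite [RHS]mulrDr; congr (_ + _); rewrite -!mulrA mulrCA.
  rewrite ler_wpM2l//; apply: le_trans (sqrt_pm_le a1 eb); apply: ler_wsqrtr.
  rewrite enorm_sqr dotv_lcomb !dotv_lcombr (dotvC x u) a2 -!enorm_sqr.
  have : e ^+ 2 * enorm x ^+ 2 <= 1 by rewrite e2; nra.
  by rewrite expr2; nra.
have h1 := H 1 (expr1n _ _); rewrite mul1r mul1r in h1.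
have h2 := H (-1); rewrite sqrrN expr1n !mulN1r normrN in h2.
have := h1 ba; have := h2 erefl ba => {H} h3 h4.
have c := cosh_le (mu * dotv u x / a).
have y1 : (mu * dotv u x / a) ^+ 2 <= mu ^+ 2.
  rewrite -mulrA exprMn ler_piMr ?sqr_ge0// -real_normK ?num_real// expr_le1//.
  by rewrite normrM normfV (gtr0_norm (lt_le_trans ltr01 a1)) ler_pdivrMr ?mul1r//; lra.
have y2 : expR (2 * (mu * dotv u x / a) ^+ 2) <= expR (2 * mu ^+ 2).
  by rewrite ler_expR ler_pM2l.
rewrite addrC expRD; have := expR_gt0 (mu * a); nra.
Qed.

(** Induction on the number of signs still to be drawn, with [u] the sum accumulated so far. In the
    potential sqrt (n + |u|^2) each pending sign counts for 1, the largest value of |X q|^2; a step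
    trades that 1 for the new vector and leaves the factor exp (2 mu^2), mu = 2 lam r. With no sign
    left, the potential is |u| and Cauchy-Schwarz applies. *)
Lemma iter_sym_step_le {I Q : finType} (p : Q -> R) (X : Q -> d.-tuple R)
    (w : I -> d.-tuple R) (lam r : R) :
  (forall q, 0 <= p q) -> \sum_q p q = 1 -> (forall q, enorm (X q) <= 1) ->
  (forall i, enorm (w i) <= r) -> 0 <= lam -> 0 <= r ->
  forall n u,
  iter n (sym_step p (fun q i => lam * dotv (w i) (X q))) expmax
    (fun i => 2 * lam * dotv (w i) u) <=
  expR (n%:R * (2 * (2 * lam * r) ^+ 2) +
        2 * lam * r * Num.sqrt (n%:R + enorm u ^+ 2)).
Proof.
move=> p0 p1 X1 wr lam0 r0; set mu := 2 * lam * r.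
have mu0 : 0 <= mu by rewrite /mu !mulr_ge0.
elim=> [|n IH] u.
  rewrite /= mul0r !add0r sqrtr_sqr ger0_norm ?enorm_ge0//.
  apply: expmax_le => [|i]; first exact: expR_ge0.
  rewrite ler_expR -[leRHS]mulrA ler_wpM2l ?mulr_ge0//.
  by apply: le_trans (ler_dotv _ _) _; rewrite ler_wpM2r ?enorm_ge0.
set rhs := leRHS.
have -> : rhs = \sum_q p q * rhs by rewrite -mulr_suml p1 mul1r.
rewrite iterS {1}/sym_step; apply: ler_sum => q _; rewrite ler_wpM2l//.
have e1 : (fun i => 2 * lam * dotv (w i) u + 2 * (lam * dotv (w i) (X q))) =
          (fun i => 2 * lam * dotv (w i) (lcomb 1 u 1 (X q))).
  by apply/funext => i; rewrite dotv_lcombr !mul1r; ring.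
have e2 : (fun i => 2 * lam * dotv (w i) u - 2 * (lam * dotv (w i) (X q))) =
          (fun i => 2 * lam * dotv (w i) (lcomb 1 u (-1) (X q))).
  by apply/funext => i; rewrite dotv_lcombr; ring.
rewrite e1 e2.
apply: (@le_trans _ _ (expR (n%:R * (2 * mu ^+ 2)) *
   ((expR (mu * Num.sqrt (n%:R + enorm (lcomb 1 u 1 (X q)) ^+ 2)) +
   expR (mu * Num.sqrt (n%:R + enorm (lcomb 1 u (-1) (X q)) ^+ 2))) / 2))).
  by rewrite mulrA ler_pM2r ?invr_gt0// mulrDr -!expRD lerD// IH.
have -> : rhs = expR (n%:R * (2 * mu ^+ 2)) *
   expR (2 * mu ^+ 2 + mu * Num.sqrt (n%:R + 1 + enorm u ^+ 2)).
  by rewrite -expRD /rhs addrA -[n.+1%:R]natr1 mulrDl mul1r.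
by rewrite ler_wpM2l ?expR_ge0// expR_sqrt_step.
Qed.

End Potential.

(** * Uniform deviation over a ball *)

Section UniformDeviation.
Context {R : realType} {d : nat} {Q : finType}.
Context (p : Q -> R) (X : Q -> d.-tuple R) (L : R -> R) (c : d.-tuple R).

Definition excess (f : d.-tuple R) q : R := L (dotv f (X q)) - L (dotv c (X q)).

(** One-sided: only an empirical excess that is too small can mislead the minimizer. The threshold
    is relative to the radius, so that [r] cancels from the final probability. *)
Definition large_deviation (r kap : R) n (v : {ffun 'I_n -> Q}) : Prop :=
  exists2 f, enorm (lcomb 1 f (-1) c) <= r &
    n%:R * (r * kap) < \sum_j (\sum_q p q * excess f q - excess f (v j)).

Lemma large_deviation_le (r kap : R) n :
  (forall q, 0 <= p q) -> \sum_q p q = 1 -> (forall q, enorm (X q) <= 1) ->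
  (forall a b, `|L a - L b| <= `|a - b|) -> 0 < r -> 0 < kap ->
  16 <= n%:R * kap ^+ 2 ->
  \sum_(v : {ffun 'I_n -> Q} | `[< large_deviation r kap v >]) \prod_j p (v j) <=
  expR (- (n%:R * kap ^+ 2 / 128)).
Proof.
move=> p0 p1 X1 Llip r0 kap0 nk.
(* Since sqrt n <= n kap / 4, the final exponent is at most n (2 mu^2 - mu kap / 4) with mu = 2 lam
   r. Its minimum is at mu = kap / 16 and equals - n kap^2 / 128. *)
pose lam := kap / (32 * r).
have lam0 : 0 < lam by rewrite divr_gt0// mulr_gt0.
(* The supremum over the ball reduces to a finite family, indexed by the
   samples: one violating f for each bad sample. *)
have [f fP] : {f : {ffun 'I_n -> Q} -> d.-tuple R & forall v,
   enorm (lcomb 1 (f v) (-1) c) <= r /\ (large_deviation r kap v ->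
    n%:R * (r * kap) < \sum_j (\sum_q p q * excess (f v) q - excess (f v) (v j)))}.
  apply: (@choice _ _ (fun v g => enorm (lcomb 1 g (-1) c) <= r /\ (large_deviation r kap v ->
    n%:R * (r * kap) < \sum_j (\sum_q p q * excess g q - excess g (v j))))) => v.
  have [[g g1 g2]|nb] := pselect (large_deviation r kap v); first by exists g.
  exists c; split=> [|//]; suff -> : lcomb 1 c (-1) c = zerov R d by rewrite enorm0 ltW.
  by apply: eq_from_tnth => i; rewrite !tnth_mktuple; ring.
pose w v := lcomb 1 (f v) (-1) c.
pose h q v := lam * excess (f v) q.
pose s q v := lam * dotv (w v) (X q).
have wE v q : dotv (w v) (X q) = dotv (f v) (X q) - dotv c (X q).
  by rewrite dotv_lcomb; ring.
have hs0 q v : `|h q v| <= `|s q v|.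
  by rewrite /h /s !normrM ler_wpM2l// wE Llip.
have hs q v v' : `|h q v - h q v'| <= `|s q v - s q v'|.
  rewrite /h /s -!mulrBr !normrM ler_wpM2l// !wE /excess.
  have -> : forall a b e : R, a - b - (e - b) = a - e by move=> *; ring.
  have -> : forall a b e : R, a - b - (e - b) = a - e by move=> *; ring.
  exact: Llip.
pose mu := 2 * lam * r.
have muE : mu = kap / 16 by rewrite /mu /lam; field; rewrite gt_eqF.
have mgf : \sum_(v : {ffun 'I_n -> Q}) (\prod_j p (v j)) *
    expmax (fun i => 0 + \sum_j (dmean p h i - h (v j) i)) <=
    expR (n%:R * (2 * mu ^+ 2) + mu * Num.sqrt n%:R).
  rewrite (@iter_dev_stepE _ _ _ p h n expmax (fun=> 0)).
  apply: le_trans (iter_dev_sym p0 p1 hs0 hs n _) _.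
  have := iter_sym_step_le p0 p1 X1 (fun v => (fP v).1) (ltW lam0) (ltW r0) n (zerov R d).
  have -> : (fun i => 2 * lam * dotv (lcomb 1 (f i) (-1) c) (zerov R d)) = (fun=> 0).
    by apply/funext => i; rewrite dotv0 mulr0.
  by rewrite enorm0 expr0n addr0.
(* Markov's inequality: for a bad sample [v], the family member of index [v] itself makes [expmax]
   exceed the threshold. *)
apply: (@le_trans _ _ (expR (- (mu * (n%:R * kap) / 2)) *
   expR (n%:R * (2 * mu ^+ 2) + mu * Num.sqrt n%:R))).
  apply: le_trans (ler_wpM2l (expR_ge0 _) mgf).
  rewrite big_mkcond mulr_sumr/=; apply: ler_sum => v _; case: asboolP => [bad|_]; last first.
    by rewrite !mulr_ge0 ?expR_ge0 ?expmax_ge0// prodr_ge0.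
  rewrite mulrCA ler_peMr ?prodr_ge0//.
  apply: le_trans (ler_wpM2l (expR_ge0 _) (expmax_ge _ v)).
  rewrite -expRD -[leLHS]expR0 ler_expR add0r addrC subr_ge0.
  have /ltW := (fP v).2 bad => /(ler_wpM2l (ltW lam0)).
  have -> : lam * (n%:R * (r * kap)) = mu * (n%:R * kap) / 2 by rewrite /mu; field.
   move=> /le_trans; apply; rewrite mulr_sumr; apply: ler_sum => j _.
  rewrite mulrBr /dmean /h lerD2r mulr_sumr; apply: ler_sum => q _.
  by rewrite mulrCA.
rewrite -expRD ler_expR muE.
set t := Num.sqrt n%:R.
have t0 : 0 <= t := sqrtr_ge0 _.
have nE : n%:R = t ^+ 2 by rewrite sqr_sqrtr.
have s4 : 4 <= kap * t.
  have h16 : 4 ^+ 2 <= (kap * t) ^+ 2 by rewrite exprMn -nE mulrC; lra.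
  have kt0 : 0 <= kap * t := mulr_ge0 (ltW kap0) t0.
  by move: h16; rewrite ler_pXn2r ?nnegrE.
rewrite nE; have : (kap * t) * 4 <= (kap * t) ^+ 2 by rewrite [leRHS]expr2 ler_wpM2l//; lra.
rewrite exprMn => h4; lra.
Qed.

End UniformDeviation.

(** * Existence, norm and localization of regularized minimizers *)

Section Minimizers.
Context {R : realType} {d : nat}.
Implicit Types (f g b : d.-tuple R).

Definition midpoint f g := lcomb 2^-1 f 2^-1 g.
Definition subv f g := lcomb 1 f (-1) g.

Lemma enorm_subv f g : enorm f <= enorm g + enorm (subv f g).
Proof.
have {1}-> : f = lcomb 1 g 1 (subv f g).
  by apply: eq_from_tnth => i; rewrite !tnth_mktuple; ring.
by apply: le_trans (enorm_lcomb _ _ _ _) _; rewrite normr1 !mul1r.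
Qed.

Lemma regul_midpoint f g :
  regul (midpoint f g) = 2^-1 * regul f + 2^-1 * regul g - 8^-1 * enorm (subv f g) ^+ 2.
Proof.
rewrite /regul /midpoint /subv !enorm_sqr !dotv_lcomb !dotv_lcombr (dotvC g f).
by field.
Qed.

Lemma regul_convex (t : R) f g : 0 <= t <= 1 ->
  regul (lcomb t f (1 - t) g) <= t * regul f + (1 - t) * regul g.
Proof.
move=> /andP[t0 t1].
have : 0 <= t * (1 - t) * enorm (subv f g) ^+ 2.
  by rewrite mulr_ge0 ?sqr_ge0// mulr_ge0// subr_ge0.
rewrite /regul /subv !enorm_sqr !dotv_lcomb !dotv_lcombr (dotvC g f).
nra.
Qed.

(** If [f] lay outside the ball, the point [g] of the segment from [c] to [f] at distance [r] from
    [c] would satisfy J g <= J c by convexity, while strong convexity of [G] at its minimizer gives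
    G g - G c >= rho r^2 / 4 > s. So deviations are needed only inside the ball. *)
Lemma argmin_localized (J G : d.-tuple R -> R) (rho r s : R) c f :
  0 < r -> 0 < rho -> s < rho * r ^+ 2 / 4 ->
  (forall t g h, 0 <= t <= 1 -> J (lcomb t g (1 - t) h) <= t * J g + (1 - t) * J h) ->
  (forall g h, G (midpoint g h) <= 2^-1 * G g + 2^-1 * G h - rho / 8 * enorm (subv g h) ^+ 2) ->
  is_argmin G c -> is_argmin J f ->
  (forall g, enorm (subv g c) <= r -> (G g - G c) - (J g - J c) <= s) ->
  enorm (subv f c) <= r /\ G f <= G c + s.
Proof.
move=> r0 rho0 sr Jconv Gconv Gc Jf dev.
have fr : enorm (subv f c) <= r.
  rewrite leNgt; apply/negP => rf.
  set D := enorm (subv f c) in rf *.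
  have D0 : 0 < D by apply: lt_trans rf.
  pose t := r / D.
  have t01 : 0 <= t <= 1.
    by apply/andP; split; [rewrite divr_ge0// ltW|rewrite ler_pdivrMr// mul1r ltW].
  pose g := lcomb t f (1 - t) c.
  have gE : subv g c = lcomb t (subv f c) 0 (subv f c).
    by apply: eq_from_tnth => i; rewrite !tnth_mktuple; ring.
  have gr : enorm (subv g c) = r.
    rewrite gE enormZ ger0_norm; last by case/andP: t01.
    by rewrite -/D /t -mulrA mulVf ?mulr1// gt_eqF.
  have Jg : J g <= J c.
    apply: le_trans (Jconv _ _ _ t01) _.
    have := ler_wpM2l (andP t01).1 (Jf c); lra.
  have := dev g; rewrite gr => /(_ (lexx _)).
  have := Gconv g c; rewrite gr; have := Gc (midpoint g c); lra.
by split=> //; have := dev _ fr; have := Jf c; lra.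
Qed.

Section Objective.
Context {K : finType} (w : K -> R) (x : K -> d.-tuple R) (L : R -> R) (rho : R) (b : d.-tuple R).
Hypothesis w_ge0 : forall k, 0 <= w k.
Hypothesis L_convex : forall t u v, 0 <= t <= 1 ->
  L (t * u + (1 - t) * v) <= t * L u + (1 - t) * L v.
Hypothesis L_lip : forall u v, `|L u - L v| <= `|u - v|.
Hypothesis rho_gt0 : 0 < rho.

(** Covers both problems: the quantized population objective has [b = 0], and the perturbed
    empirical one has constant weights and the scaled noise as [b]. *)
Definition objective f : R :=
  \sum_k w k * L (dotv f (x k)) + rho * regul f + dotv b f.

Lemma sum_loss_convex t f g : 0 <= t <= 1 ->
  \sum_k w k * L (dotv (lcomb t f (1 - t) g) (x k)) <=
  t * \sum_k w k * L (dotv f (x k)) + (1 - t) * \sum_k w k * L (dotv g (x k)).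
Proof.
move=> t01; rewrite !mulr_sumr -big_split/=; apply: ler_sum => k _.
rewrite dotv_lcomb (mulrCA t) (mulrCA (1 - t)) -mulrDr ler_wpM2l//.
exact: L_convex.
Qed.

Lemma objective_convex t f g : 0 <= t <= 1 ->
  objective (lcomb t f (1 - t) g) <= t * objective f + (1 - t) * objective g.
Proof.
move=> t01; rewrite /objective dotv_lcombr.
have := sum_loss_convex f g t01; have := ler_wpM2l (ltW rho_gt0) (regul_convex f g t01).
lra.
Qed.

Lemma objective_midpoint f g : objective (midpoint f g) <=
  2^-1 * objective f + 2^-1 * objective g - rho / 8 * enorm (subv f g) ^+ 2.
Proof.
have t01 : 0 <= (2^-1 : R) <= 1 by apply/andP; split; lra.
have := sum_loss_convex f g t01; have -> : 1 - 2^-1 = 2^-1 :> R by lra.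
rewrite /objective -/(midpoint f g) regul_midpoint /midpoint dotv_lcombr; lra.
Qed.

Let W := \sum_k w k * enorm (x k) + enorm b.

Let W0 : 0 <= W.
Proof.
apply: addr_ge0; last exact: enorm_ge0.
by apply: sumr_ge0 => k _; rewrite mulr_ge0 ?enorm_ge0.
Qed.

Lemma objective_growth f :
  objective (zerov R d) + rho * regul f - W * enorm f <= objective f.
Proof.
rewrite /objective dotv0 {1}/regul enorm0 expr0n/= !mulr0 !addr0.
have h1 : - (enorm b * enorm f) <= dotv b f.
  by have := cauchy_schwarz b f; rewrite ler_norml => /andP[].
have h2 : \sum_k w k * L (dotv (zerov R d) (x k)) - (\sum_k w k * enorm (x k)) * enorm f <=
    \sum_k w k * L (dotv f (x k)).
  rewrite mulr_suml -sumrB; apply: ler_sum => k _; rewrite -mulrA -mulrBr ler_wpM2l//.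
  have := L_lip (dotv (zerov R d) (x k)) (dotv f (x k)).
  rewrite [dotv (zerov R d) _]dotvC dotv0 sub0r normrN ler_norml => /andP[_].
  have := cauchy_schwarz f (x k); lra.
rewrite /W; lra.
Qed.

Lemma argmin_enorm f : is_argmin objective f -> enorm f <= 2 * W / rho.
Proof.
move=> /(_ (zerov R d)) h; have := objective_growth f.
rewrite /regul => g; have {g h} : rho * (2^-1 * enorm f ^+ 2) <= W * enorm f by lra.
have [-> _|f0] := eqVneq (enorm f) 0.
  by apply: divr_ge0; [exact: mulr_ge0|exact: ltW].
have {}f0 : 0 < enorm f by rewrite lt0r f0 enorm_ge0.
rewrite expr2 !mulrA ler_pM2r// => h.
rewrite ler_pdivlMr//; lra.
Qed.

(** Outside the box of half-side 2 W / rho the quadratic growth beats the value at 0; inside,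
    compactness applies. *)
Lemma objective_argmin : exists f, is_argmin objective f.
Proof.
pose M := 2 * W / rho.
have M0 : 0 <= M by apply: divr_ge0; [exact: mulr_ge0|exact: ltW].
(* Row vectors supply the topology in which boxes are compact. *)
pose T (v : 'rV[R]_d) : d.-tuple R := [tuple v ord0 i | i < d].
pose V f : 'rV[R]_d := \row_i tnth f i.
have VK : cancel V T by move=> f; apply: eq_from_tnth => i; rewrite tnth_mktuple mxE.
pose A : set 'rV[R]_d := [set v | forall i, `[- M, M]%classic (v ord0 i)].
have cA : compact A.
  by apply: (@rV_compact _ _ (fun=> `[- M, M]%classic)) => i; exact: segment_compact.
have L_cont : continuous L.
  move=> u; apply/cvgrPdist_lt => e e0; near=> v.
  apply: le_lt_trans (L_lip _ _) _; near: v.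
  exact: (@cvgr_dist_lt _ _ _ _ _ id u).
have sum_cont (I : finType) (a : I -> 'rV[R]_d -> R) : (forall i, continuous (a i)) ->
    continuous (fun v => \sum_i a i v).
  by move=> ac; apply: (@continuous_big _ _ +%R 0 xpredT (@add_continuous R)) => i _.
have coordc i : continuous (fun v : 'rV[R]_d => v ord0 i) by exact: coord_continuous.
have mul_cont (f g : 'rV[R]_d -> R) : continuous f -> continuous g ->
    continuous (fun v => f v * g v).
  by move=> fc gc v; exact: continuousM (fc v) (gc v).
have cst_cont (a : R) : continuous (fun _ : 'rV[R]_d => a) by exact: cst_continuous.
have dot_cont (a : d.-tuple R) : continuous (fun v => dotv a (T v)).
  apply: sum_cont => i.
  rewrite (_ : (fun _ => _) = (fun v : 'rV[R]_d => tnth a i * v ord0 i)); last first.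
    by apply/funext => u; rewrite tnth_mktuple.
  exact: mul_cont.
have cJ1 : continuous (fun v => \sum_k w k * L (dotv (T v) (x k))).
  apply: sum_cont => k; apply: mul_cont => // v.
  apply: (@continuous_comp _ _ _ (fun v => dotv (T v) (x k)) L); last exact: L_cont.
  move: v; rewrite (_ : (fun _ => _) = (fun v => dotv (x k) (T v))); first exact: dot_cont.
  by apply/funext => u; rewrite dotvC.
have cJ2 : continuous (fun v => dotv (T v) (T v)).
  apply: sum_cont => i.
  rewrite (_ : (fun _ => _) = (fun v : 'rV[R]_d => v ord0 i * v ord0 i)); last first.
    by apply/funext => u; rewrite !tnth_mktuple.
  exact: mul_cont.
have cJ : continuous (objective \o T).
  rewrite (_ : _ \o _ = (fun v => \sum_k w k * L (dotv (T v) (x k)) +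
    rho * 2^-1 * dotv (T v) (T v) + dotv b (T v))); last first.
    by apply/funext => v; rewrite /objective/= /regul enorm_sqr mulrA.
  have cJ2' := mul_cont _ _ (cst_cont (rho * 2^-1)) cJ2.
  by move=> v; exact: continuousD (continuousD (cJ1 v) (cJ2' v)) (dot_cont b v).
have V0A : A (V (zerov R d)).
  by move=> i; rewrite /= mxE tnth_mktuple in_itv/= M0 oppr_le0 M0.
have [v vA vmin] := compact_EVT_min (ex_intro _ _ V0A) cA (continuous_subspaceT cJ).
exists (T v) => g.
have [gA|gA] := pselect (A (V g)).
  by have := vmin (V g); rewrite inE => /(_ gA) /=; rewrite VK.
have := vmin (V (zerov R d)); rewrite inE => /(_ V0A) /=; rewrite VK => /le_trans; apply.
apply: le_trans (objective_growth g); rewrite -addrA lerDl subr_ge0.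
have [gM|Mg] := ltP (enorm g) M.
  exfalso; apply: gA => i; rewrite /= mxE in_itv/= -ler_norml.
  by apply: le_trans (ltW gM); exact: ler_tnth_enorm.
rewrite /regul expr2 !mulrA ler_wpM2r ?enorm_ge0//.
have : rho * M = 2 * W by rewrite /M mulrC divfK// gt_eqF.
have := ler_wpM2l (ltW rho_gt0) Mg; lra.
Unshelve. all: by end_near. Qed.

End Objective.
End Minimizers.

(** * Integrals of nonnegative functions without measurability *)

Section NonnegativeIntegrals.
Local Open Scope ereal_scope.
Import HBNNSimple.

(* The integral of a nonnegative function is defined as a supremum over the
   simple functions below it, so monotonicity and scaling need no measurability;
   this spares us the measurability of the inner integrals in [lebint]. *)
Lemma ge0_le_integral_nomeas dT (T : measurableType dT) (R : realType)
    (mu : {measure set T -> \bar R}) (f g : T -> \bar R) :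
  (forall x, 0 <= f x) -> (forall x, f x <= g x) ->
  \int[mu]_x f x <= \int[mu]_x g x.
Proof.
move=> f0 fg; have g0 x : 0 <= g x by apply: le_trans (fg x).
rewrite !ge0_integralTE//; apply: le_ereal_sup => _ [h /= hf <-].
by exists h => //= x; apply: le_trans (fg x).
Qed.

Lemma ge0_integral_le_simple dT (T : measurableType dT) (R : realType)
    (mu : {measure set T -> \bar R}) (f : T -> \bar R) M :
  (forall x, 0 <= f x) ->
  (forall h : {nnsfun T >-> R}, (forall x, (h x)%:E <= f x) -> \int[mu]_x (h x)%:E <= M) ->
  \int[mu]_x f x <= M.
Proof.
move=> f0 H; rewrite ge0_integralTE//; apply: ge_ereal_sup => _ [h /= hf <-].
by rewrite -integralT_nnsfun H.
Qed.

(** Rescaling simple functions gives <= for every positive factor; using it for [c] and for its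
    inverse gives equality. *)
Lemma ge0_integralZ_nomeas dT (T : measurableType dT) (R : realType)
    (mu : {measure set T -> \bar R}) (f : T -> \bar R) (c : R) :
  (0 < c)%R -> (forall x, 0 <= f x) -> \int[mu]_x (c%:E * f x) = c%:E * \int[mu]_x f x.
Proof.
have le_Z (b : R) (g : T -> \bar R) : (0 < b)%R -> (forall x, 0 <= g x) ->
    \int[mu]_x (b%:E * g x) <= b%:E * \int[mu]_x g x.
  move=> b0 g0; apply: ge0_integral_le_simple => [x|h hg].
    by rewrite mule_ge0// lee_fin ltW.
  have -> : \int[mu]_x (h x)%:E = b%:E * \int[mu]_x ((b^-1)%:E * (h x)%:E).
    rewrite -ge0_integralZl//; last first.
    - by rewrite lee_fin ltW.
    - by move=> x _; rewrite -EFinM lee_fin mulr_ge0// invr_ge0 ltW.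
    - by apply: emeasurable_funM => //; exact/measurable_EFinP.
    by apply: eq_integral => x _; rewrite -!EFinM mulrA mulfV ?gt_eqF// mul1r.
  rewrite lee_pmul2l//; apply: ge0_le_integral_nomeas => x.
    by rewrite -EFinM lee_fin mulr_ge0// invr_ge0 ltW.
  by rewrite -(@lee_pmul2l _ b%:E)// -!EFinM mulrA mulfV ?gt_eqF// mul1r.
move=> c0 f0; apply/eqP; rewrite eq_le le_Z//=.
have := le_Z c^-1%R (fun x => c%:E * f x); rewrite invr_gt0 c0 => /(_ isT) H.
rewrite -(@lee_pmul2l _ (c^-1)%:E) ?lte_fin ?invr_gt0//.
rewrite muleA -EFinM mulVf ?gt_eqF// mul1e.
have E : f = fun x => (c^-1)%:E * (c%:E * f x).
  by apply/funext => x; rewrite muleA -EFinM mulVf ?gt_eqF// mul1e.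
by rewrite [in leLHS]E; apply: H => x; rewrite mule_ge0// lee_fin ltW.
Qed.

Context {R : realType}.
Let leb := @lebesgue_measure R.

Lemma lebesgue_measure_dilation (c : R) (A : set R) : (0 < c)%R -> measurable A ->
  c%:E * pushforward leb (( *%R c) : measurableTypeR R -> measurableTypeR R) A = leb A.
Proof.
move=> c0 mA.
have mc : measurable_fun setT (( *%R c) : measurableTypeR R -> measurableTypeR R).
  exact: mulrl_measurable.
pose nu : {measure set (measurableTypeR R) -> \bar R} := mscale (NngNum (ltW c0))
  (measure_function_pushforward__canonical__measure_function_Measure leb mc).
rewrite -[LHS]/(nu A); apply/esym/lebesgue_measure_unique => //= _ [[a b]] _ <-.
rewrite /nu /mscale /pushforward/=.
rewrite [X in _ = _ * leb X](_ : _ = `]c^-1 * a, c^-1 * b]%classic%R); last first.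
  apply/seteqP; split=> x /=; rewrite !in_itv/=.
    by rewrite ltr_pdivrMl// ler_pdivlMl.
  by rewrite ltr_pdivrMl// ler_pdivlMl.
rewrite /leb !lebesgue_measure_itv/= !lte_fin ltr_pM2l ?invr_gt0//.
case: ifP => _; last by rewrite mule0.
by rewrite -!EFinB -EFinM -mulrBr mulrA mulfV ?gt_eqF// mul1r.
Qed.

(** Change of variables is applied only to simple functions, giving <= for every [c]; the dilation
    by the inverse gives the converse. *)
Lemma ge0_integral_dilation (c : R) (f : R -> \bar R) : (0 < c)%R -> (forall x, 0 <= f x) ->
  \int[leb]_x f (c * x)%R = (c^-1)%:E * \int[leb]_x f x.
Proof.
have meas (b : R) (g : R -> \bar R) : (0 < b)%R -> measurable_fun setT g ->
    (forall x, 0 <= g x) -> b%:E * \int[leb]_x g (b * x)%R = \int[leb]_x g x.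
  move=> b0 mg g0.
  have mb : measurable_fun setT (( *%R b) : measurableTypeR R -> measurableTypeR R).
    exact: mulrl_measurable.
  have -> : \int[leb]_x g (b * x)%R = \int[pushforward leb (( *%R b) : measurableTypeR R -> measurableTypeR R)]_x g x.
    by rewrite ge0_integral_pushforward.
  rewrite -[LHS](@ge0_integral_mscale _ _ _ _ _ measurableT (NngNum (ltW b0)))//.
  apply: eq_measure_integral => A mA _; exact: lebesgue_measure_dilation.
have le_D (b : R) (g : R -> \bar R) : (0 < b)%R -> (forall x, 0 <= g x) ->
    \int[leb]_x g (b * x)%R <= (b^-1)%:E * \int[leb]_x g x.
  move=> b0 g0; apply: ge0_integral_le_simple => // h hg.
  have bV : (0 < b^-1)%R by rewrite invr_gt0.
  have <- : (b^-1)%:E * \int[leb]_x (h (b^-1 * x)%R)%:E = \int[leb]_x (h x)%:E.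
    apply: (meas _ (EFin \o h)) => //.
      apply/measurable_EFinP; exact: (@measurable_funPT _ _ _ _ h).
    by move=> x /=; rewrite lee_fin.
  rewrite lee_pmul2l//; apply: ge0_le_integral_nomeas => x; first by rewrite lee_fin.
  by apply: le_trans (hg _) _; rewrite mulrA mulfV ?gt_eqF// mul1r.
move=> c0 f0; apply/eqP; rewrite eq_le le_D//=.
have := le_D c^-1%R (fun x => f (c * x)%R); rewrite invr_gt0 c0 => /(_ isT (fun=> f0 _)).
rewrite invrK => H.
rewrite -(@lee_pmul2l _ c%:E) ?lte_fin// muleA -EFinM mulfV ?gt_eqF// mul1e.
have E : f = fun x => f (c * (c^-1 * x))%R.
  by apply/funext => x; rewrite mulrA mulfV ?gt_eqF// mul1r.
by rewrite [in leLHS]E.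
Qed.

Lemma integral_laplace (c : R) : (0 < c)%R ->
  \int[leb]_t (expR (- (c * `|t|)))%:E = (2 / c)%:E.
Proof.
move=> c0; rewrite /leb ge0_symfun_integralT; last 3 first.
- by move=> x; exact: expR_ge0.
- move=> x; apply: continuous_comp; last exact: continuous_expR.
  apply: continuousN; apply: continuousM; first exact: cst_continuous.
  exact: norm_continuous.
- by move=> x /=; rewrite normrN.
have -> : [set x : R | (0 <= x)%R] = `[0%R, +oo[%classic.
  by apply/seteqP; split=> x /=; rewrite in_itv/= andbT.
have h := integral_exponential_pdf c0.
have -> : \int[@lebesgue_measure R]_(x in `[0%R, +oo[) (expR (- (c * `|x|)))%:E = (c^-1)%:E.
  rewrite -[RHS]mule1 -h -ge0_integralZ_nomeas ?invr_gt0//; last first.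
    by move=> x; rewrite lee_fin exponential_pdf_ge0// ltW.
  rewrite [LHS]integral_mkcond; apply: eq_integral => x _.
  rewrite patchE; case: ifPn => [|xn].
    rewrite inE/= in_itv/= andbT => x0; rewrite exponential_pdfE// ger0_norm//.
    by rewrite -EFinM mulrA mulVf ?gt_eqF// mul1r mulNr.
  by rewrite /exponential_pdf patchE (negbTE xn) mule0.
by rewrite -EFinM.
Qed.

End NonnegativeIntegrals.

(** * Iterated Lebesgue integrals: scaling, dilation, products *)

Section IteratedIntegral.
Context {R : realType}.
Local Open Scope ereal_scope.
Implicit Types g : (nat -> R) -> \bar R.

Lemma lebint_ge0 n g : (forall x, 0 <= g x) -> 0 <= lebint n g.
Proof. by elim: n g => [|n IH] g g0 //=; apply: integral_ge0 => t _; exact: IH. Qed.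

Lemma lebint_le n g1 g2 : (forall x, 0 <= g1 x) -> (forall x, g1 x <= g2 x) ->
  lebint n g1 <= lebint n g2.
Proof.
elim: n g1 g2 => [|n IH] g1 g2 g0 g12 //=.
by apply: ge0_le_integral_nomeas => t; [exact: lebint_ge0|exact: IH].
Qed.

Lemma lebintZ n g (c : R) : (0 < c)%R -> (forall x, 0 <= g x) ->
  lebint n (fun x => c%:E * g x) = c%:E * lebint n g.
Proof.
move=> c0; elim: n g => [|n IH] g g0 //=.
rewrite -ge0_integralZ_nomeas// => [|t]; last exact: lebint_ge0.
by apply: eq_integral => t _; exact: IH.
Qed.

Lemma lebint_dilation n g (c : R) : (0 < c)%R -> (forall x, 0 <= g x) ->
  lebint n (fun x => g (fun k => c * x k)%R) = (c^-1 ^+ n)%:E * lebint n g.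
Proof.
move=> c0; elim: n g => [|n IH] g g0 /=.
  by rewrite expr0 mul1e; congr g; apply/funext => k; rewrite mulr0.
pose F t := lebint n (fun x => g (fun k => if k == n then t else x k)).
have F0 t : 0 <= F t by exact: lebint_ge0.
rewrite exprSr EFinM -muleA -ge0_integral_dilation// -ge0_integralZ_nomeas//; last 2 first.
- by rewrite exprn_gt0// invr_gt0.
- by move=> t; exact: F0.
apply: eq_integral => t _; rewrite /F -IH//; congr lebint; apply/funext => x.
by congr g; apply/funext => k; case: eqP.
Qed.

Lemma lebint_prod n (phi : R -> R) (K : R) : (forall t, 0 < phi t)%R -> (0 < K)%R ->
  \int[@lebesgue_measure R]_t (phi t)%:E = K%:E ->
  lebint n (fun x => (\prod_(i < n) phi (x i))%:E) = (K ^+ n)%:E.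
Proof.
move=> phi0 K0 phiK; elim: n => [|n IH] /=; first by rewrite big_ord0.
rewrite exprS mulrC EFinM -phiK -ge0_integralZ_nomeas ?exprn_gt0//; last first.
  by move=> t; rewrite lee_fin ltW.
apply: eq_integral => t _; rewrite -IH muleC -lebintZ//; last first.
  by move=> x; rewrite lee_fin prodr_ge0// => i _; exact: ltW.
congr lebint; apply/funext => x; rewrite big_ord_recr/= eqxx mulrC EFinM.
congr (_ * _%:E); apply: eq_bigr => i _.
by rewrite ltn_eqF.
Qed.

Lemma exp_sum_prod n (c : R) (x : nat -> R) :
  (expR (- (c * \sum_(i < n) `|x i|)) = \prod_(i < n) expR (- (c * `|x i|)))%R.
Proof. by rewrite mulr_sumr -sumrN expR_sum. Qed.

End IteratedIntegral.

(** * Normalization and tail of the noise *)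

Section NoiseTail.
Context {R : realType} {d : nat}.
Implicit Types (a c : R).

Definition noise_weight a : \bar R :=
  lebint_vec (fun e : d.-tuple R => (expR (- a * enorm e))%:E).

(** The law of the noise is given multiplied by this weight, which must be finite and positive to be
    cancelled. Comparing the Euclidean norm with the sum of absolute values sandwiches it between
    products of Laplace integrals. *)
Lemma noise_weight_fin a : 0 < a -> exists2 Z : R, 0 < Z & noise_weight a = Z%:E.
Proof.
move=> a0; pose tup (x : nat -> R) : d.-tuple R := [tuple x (nat_of_ord i) | i < d].
have lap c : 0 < c -> lebint d (fun x => (expR (- (c * \sum_(i < d) `|x i|)))%:E) =
    ((2 / c) ^+ d)%:E.
  move=> c0; rewrite -(lebint_prod d (fun t => expR_gt0 _) (divr_gt0 (ltr0Sn R 1) c0) (integral_laplace c0)).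
  by congr lebint; apply/funext => x; rewrite exp_sum_prod.
have lb : (((2 / a) ^+ d)%:E <= noise_weight a)%E.
  rewrite -lap// /noise_weight /lebint_vec; apply: lebint_le => x; rewrite lee_fin ?expR_ge0//.
  rewrite ler_expR mulNr lerN2 ler_pM2l//; apply: le_trans (enorm_le_sum _) _.
  by rewrite le_eqVlt; apply/orP; left; apply/eqP/eq_bigr => i _; rewrite tnth_mktuple.
(* [d.+1] rather than [d] keeps the rate meaningful for [d = 0]. *)
have ub : (noise_weight a <= ((2 / (a / d.+1%:R)) ^+ d)%:E)%E.
  rewrite -lap ?divr_gt0// /noise_weight /lebint_vec; apply: lebint_le => x; rewrite lee_fin ?expR_ge0//.
  rewrite ler_expR mulNr lerN2 -mulrA ler_pM2l// ler_pdivrMl//.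
  apply: (@le_trans _ _ (\sum_(i < d) enorm (tup x))).
    apply: ler_sum => i _; have := ler_tnth_enorm (tup x) i.
    by rewrite tnth_mktuple.
  rewrite sumr_const card_ord -[leLHS]mulr_natl ler_wpM2r ?enorm_ge0// ler_nat.
  exact: leqnSn.
have : noise_weight a \is a fin_num.
  rewrite fin_numE; apply/andP; split; apply/eqP => E; move: lb ub; rewrite E.
    by rewrite leeNy_eq.
  by rewrite leye_eq.
move=> /fineK E; exists (fine (noise_weight a)) => //.
move: lb; rewrite -E lee_fin; apply: lt_le_trans.
by rewrite exprn_gt0// divr_gt0.
Qed.

Lemma noise_weight_half a : 0 < a ->
  noise_weight (a / 2) = ((2 ^+ d)%:E * noise_weight a)%E.
Proof.
move=> a0; have -> : 2 ^+ d = (2^-1)^-1 ^+ d :> R by rewrite invrK.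
rewrite /noise_weight /lebint_vec -lebint_dilation ?invr_gt0//.
congr lebint; apply/funext => x; congr ((expR _)%:E).
set e : d.-tuple R := [tuple x i | i < d].
rewrite (_ : [tuple _ | i < d] = lcomb 2^-1 e 0 e).
  by rewrite enormZ ger0_norm ?invr_ge0//; ring.
by apply: eq_from_tnth => i; rewrite !tnth_mktuple; ring.
Qed.

(* Chernoff bound with parameter a / 2: dilating by 2 the weight
   exp (- (a / 2) * |e|) gives the factor 2 ^+ d. *)
Lemma noise_tail a t : 0 < a -> 0 <= t ->
  (lebint_vec (fun e : d.-tuple R =>
     (\1_[set e | (t < enorm e)%R] e)%:E * (expR (- a * enorm e))%:E) <=
   (expR (- (a / 2 * t)) * 2 ^+ d)%:E * noise_weight a)%E.
Proof.
move=> a0 t0; rewrite EFinM -muleA -noise_weight_half// /noise_weight /lebint_vec -lebintZ//.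
- apply: lebint_le => x.
    by rewrite -EFinM lee_fin mulr_ge0// expR_ge0.
  rewrite -!EFinM lee_fin -expRD indicE; case: (boolP (_ \in _)) => [|_]; last first.
    by rewrite mul0r expR_ge0.
  rewrite inE/= mul1r ler_expR => te; nra.
- exact: expR_gt0.
Qed.

End NoiseTail.

(** * Integration through a finite partition *)

Section FiniteFactor.
Context {R : realType} {dT : measure_display} {T : measurableType dT} (P : probability T R).
Context {Q : finType} (q : T -> Q).
Hypothesis mq : forall v, measurable (q @^-1` [set v]).

Definition cell_mass v : R := fine (P (q @^-1` [set v])).

Lemma cell_massE v : (cell_mass v)%:E = P (q @^-1` [set v]).
Proof. by rewrite fineK// fin_num_measure. Qed.

Lemma cell_mass_ge0 v : 0 <= cell_mass v.
Proof. by rewrite fine_ge0. Qed.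

Lemma factor_indicE (k : Q -> R) z :
  (k (q z))%:E = (\sum_v (k v)%:E * (\1_(q @^-1` [set v]) z)%:E)%E.
Proof.
rewrite (bigD1 (q z))//= big1 => [|v vq].
  by rewrite adde0 indicE mem_set// mule1.
by rewrite indicE memNset ?mule0// => /= E; rewrite E eqxx in vq.
Qed.

Lemma integrable_factor (k : Q -> R) : P.-integrable setT (EFin \o (k \o q)).
Proof.
rewrite (_ : _ \o _ = fun z => (\sum_v (k v)%:E * (\1_(q @^-1` [set v]) z)%:E)%E); last first.
  by apply/funext => z; rewrite -factor_indicE.
apply: integrable_sum => // v _; apply: integrableZl => //.
exact: integrable_indic.
Qed.

Lemma integral_factor (k : Q -> R) :
  (\int[P]_z (k (q z))%:E = (\sum_v cell_mass v * k v)%:E)%E.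
Proof.
under eq_integral do rewrite factor_indicE.
rewrite integral_sum//; last first.
  by move=> v; apply: integrableZl => //; exact: integrable_indic.
rewrite -sumEFin; apply: eq_bigr => v _.
rewrite integralZl//; last exact: integrable_indic.
rewrite mulrC EFinM cell_massE; congr (_ * _)%E.
by rewrite integral_indic// setIT.
Qed.

Lemma cell_mass_sum : \sum_v cell_mass v = 1.
Proof.
apply/EFin_inj; have := integral_factor (fun=> 1).
under [in RHS]eq_bigr do rewrite mulr1.
by move=> <-; rewrite integral_cst// mul1e; exact: probability_setT.
Qed.

Lemma integral_near_factor (h : T -> R) (k : Q -> R) (G : set T) (c : R) :
  measurable_fun setT h -> measurable G -> P G = 1%E -> 0 <= c ->
  (forall z, G z -> `|h z - k (q z)| <= c) ->
  `|fine (\int[P]_z (h z)%:E)%E - \sum_v cell_mass v * k v| <= c.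
Proof.
move=> mh mG PG c0 hk.
have mk : measurable_fun setT (k \o q).
  by have /integrableP[/measurable_EFinP] := integrable_factor k.
(* Changing [h] off the full-measure set [G] makes it uniformly close to [k \o q], and integrability
   follows. *)
pose h' z := if `[< G z >] then h z else k (q z).
have mh' : measurable_fun setT h'.
  apply: measurable_fun_ifT => //.
  apply: (@measurable_fun_bool _ _ _ _ true); rewrite setTI.
  rewrite (_ : _ @^-1` _ = G)//; apply/seteqP; split=> z /=; first by move/asboolP.
  by move=> Gz; apply/asboolP.
have h'k z : `|h' z - k (q z)| <= c.
  by rewrite /h'; case: asboolP => [/hk//|_]; rewrite subrr normr0.
have PnG : P (~` G) = 0%E by rewrite probability_setC// PG subee.
have -> : (\int[P]_z (h z)%:E = \int[P]_z (h' z)%:E)%E.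
  apply: ae_eq_integral => //; [exact/measurable_EFinP|exact/measurable_EFinP|].
  exists (~` G); split; first exact: measurableC.
    exact: PnG.
  move=> z /= nG Gz; apply: nG => _; rewrite /h'.
  by case: asboolP.
have ik := integrable_factor k.
have ic : P.-integrable setT (EFin \o (fun=> c)).
  by apply: finite_measure_integrable_cst.
have ih' : P.-integrable setT (EFin \o h').
  apply: (@le_integrable _ _ _ _ _ measurableT _ (fun z => `|(k (q z))%:E| + c%:E)%E).
  - exact/measurable_EFinP.
  - move=> z _; rewrite -[leRHS]/(`| `|k (q z)| + c |%:E) /= lee_fin.
    rewrite [leRHS]ger0_norm ?addr_ge0//.
    have -> : h' z = k (q z) + (h' z - k (q z)) by ring.
    by apply: le_trans (ler_normD _ _) _; rewrite lerD2l.
  - exact: (integrableD measurableT (integrable_abse ik) ic).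
have e1 : \sum_v cell_mass v * k v = Rintegral P setT (k \o q).
  by rewrite /Rintegral integral_factor.
have e2 : Rintegral P setT (fun=> c) = c.
  by rewrite Rintegral_cst// [X in fine X](_ : _ = 1%E) ?mulr1//; exact: probability_setT.
have l1 : Rintegral P setT (k \o q) <= Rintegral P setT (fun z => h' z + c).
  apply: le_Rintegral => //; first exact: (integrableD measurableT ih' ic).
  by move=> z _; rewrite -lerBlDl; apply: le_trans (ler_norm _) _; rewrite distrC; exact: h'k.
have l2 : Rintegral P setT h' <= Rintegral P setT (fun z => (k \o q) z + c).
  apply: le_Rintegral => //; first exact: (integrableD measurableT ik ic).
  by move=> z _; rewrite -lerBlDl; apply: le_trans (ler_norm _) _; exact: h'k.
rewrite !RintegralD// e2 in l1 l2.
rewrite e1 -/(Rintegral P setT h') ler_norml.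
by apply/andP; split; lra.
Qed.

End FiniteFactor.

(** * Quantization of the samples *)

Section Quantizer.
Context {R : realType} {d : nat}.
Local Notation sample := (d.-tuple R * R)%type.

Definition signed_input (z : sample) : d.-tuple R := lcomb z.2 z.1 0 z.1.

Definition supported : set sample := [set z | enorm z.1 <= 1 /\ (z.2 = 1 \/ z.2 = -1)].

Lemma dotv_signed_input f z : dotv f (signed_input z) = z.2 * dotv f z.1.
Proof. by rewrite dotv_lcombr mul0r addr0. Qed.

Lemma enorm_signed_input z : supported z -> enorm (signed_input z) <= 1.
Proof. by move=> [z1 [] e]; rewrite enormZ e ?normrN normr1 mul1r. Qed.

Lemma measurable_dotvr (f : d.-tuple R) : measurable_fun setT (dotv f).
Proof.
by apply: measurable_sum => i; apply: measurable_funM => //; exact: measurable_tnth.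
Qed.

Lemma measurable_enorm : measurable_fun setT (@enorm R d).
Proof.
have : measurable_fun setT (fun v : d.-tuple R => dotv v v).
  by apply: measurable_sum => i; apply: measurable_funM; exact: measurable_tnth.
by move=> mv; apply: (measurableT_comp _ mv); apply: continuous_measurable_fun; exact: sqrt_continuous.
Qed.

Lemma measurable_supported : measurable supported.
Proof.
have m1 : measurable_fun setT (fun z : sample => enorm z.1).
  exact: (measurableT_comp measurable_enorm measurable_fst).
have -> : supported = ((fun z : sample => enorm z.1) @^-1` `]-oo, 1]) `&`
    (snd @^-1` [set 1] `|` snd @^-1` [set -1]).
  apply/seteqP; split=> z /=; rewrite in_itv/=; first by case=> ? [] e; split => //; [left|right].
  by move=> [? [] e]; split => //; [left|right].
apply: measurableI; first by rewrite -[X in measurable X]setTI; apply: m1.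
by apply: measurableU; rewrite -[X in measurable X]setTI; apply: measurable_snd.
Qed.

(** A cell records which thresholds -1 + k t lie above each coordinate of y x, so it is cut out by
    half-lines. Its representative is an input from the cell itself, which keeps the norm at most 1;
    cells without supported samples get 0. *)
Lemma quantizer_exists (tau : R) : 0 < tau ->
  exists (Q : finType) (q : sample -> Q) (X : Q -> d.-tuple R),
  [/\ forall v, measurable (q @^-1` [set v]), forall v, enorm (X v) <= 1 &
      forall z, supported z -> enorm (subv (signed_input z) (X (q z))) <= tau].
Proof.
(* Errors of at most [t] in [d] coordinates add up to at most [tau]. *)
move=> tau0; pose t := tau / d.+1%:R.
have t0 : 0 < t by rewrite divr_gt0.
pose M := (Num.truncn (2 / t)).+1.
pose q (z : sample) : {ffun 'I_d * 'I_M -> bool} :=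
  [ffun ik : 'I_d * 'I_M => z.2 * tnth z.1 ik.1 < -1 + (ik.2 : nat)%:R * t].
have mcoord (i : 'I_d) : measurable_fun setT (fun z : sample => z.2 * tnth z.1 i).
  apply: measurable_funM; first exact: measurable_snd.
  exact: (measurableT_comp (measurable_tnth i) measurable_fst).
have mq v : measurable (q @^-1` [set v]).
  have -> : q @^-1` [set v] = \bigcap_(ik in [set: 'I_d * 'I_M])
     [set z | (z.2 * tnth z.1 ik.1 < -1 + (ik.2 : nat)%:R * t) = v ik].
    apply/seteqP; split=> z /=; first by move=> <- ik _; rewrite ffunE.
    by move=> H; apply/ffunP => ik; rewrite ffunE; exact: H.
  apply: fin_bigcap_measurable => // ik _.
  have m : measurable [set z : sample | z.2 * tnth z.1 ik.1 < -1 + (ik.2 : nat)%:R * t].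
    rewrite -[X in measurable X]setTI.
    have := mcoord ik.1 measurableT _ (measurable_itv `]-oo, (-1 + (ik.2 : nat)%:R * t)[).
    by congr measurable; apply/seteqP; split=> z /=; rewrite in_itv.
  case: (v ik); first exact: m.
  rewrite (_ : [set z | _] = ~` [set z : sample | z.2 * tnth z.1 ik.1 < -1 + (ik.2 : nat)%:R * t]).
    exact: measurableC.
  by apply/seteqP; split=> z /=; [move=> ->|move/negP/negbTE].
have close z z' : supported z -> supported z' -> q z = q z' ->
    enorm (subv (signed_input z) (signed_input z')) <= tau.
  have half (y y' : sample) i : supported y -> supported y' -> q y = q y' ->
      y'.2 * tnth y'.1 i - y.2 * tnth y.1 i <= t.
    move=> sy sy' qy; rewrite leNgt; apply/negP => lt.
    set a := y.2 * _ in lt; set b := y'.2 * _ in lt.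
    have tnthE (w : sample) : tnth (signed_input w) i = w.2 * tnth w.1 i.
      by rewrite tnth_mktuple; ring.
    have a1 : `|a| <= 1.
      by rewrite /a -tnthE; apply: le_trans (ler_tnth_enorm _ _) (enorm_signed_input sy).
    have b1 : `|b| <= 1.
      by rewrite /b -tnthE; apply: le_trans (ler_tnth_enorm _ _) (enorm_signed_input sy').
    move: a1 b1; rewrite !ler_norml => /andP[a1 a2] /andP[b1 b2].
    (* Threshold [k] is the last one not above [b]. As b - a > t, it lies strictly above [a], so bit
       [k] separates the samples. *)
    pose k := Num.truncn ((b + 1) / t).
    have b0 : 0 <= (b + 1) / t by rewrite divr_ge0 ?ltW//; lra.
    have /andP[k1 k2] := truncn_itv b0.
    have kM : (k < M)%N.
      rewrite ltnS; apply: le_truncn; rewrite ler_pM2r ?invr_gt0//; lra.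
    rewrite ler_pdivlMr// in k1; rewrite ltr_pdivrMr// -natr1 in k2.
    have := congr1 (fun f : {ffun _ -> _} => f (i, Ordinal kM)) qy; rewrite !ffunE/= -/a -/b -/k.
    have -> : a < -1 + k%:R * t by lra.
    by move/esym; rewrite ltNge (_ : _ <= _)//; lra.
  move=> sz sz' qz; apply: le_trans (enorm_le_sum _) _.
  apply: (@le_trans _ _ (\sum_(i < d) t)).
    apply: ler_sum => i _; rewrite ler_norml !tnth_mktuple.
    have := half _ _ i sz sz' qz; have := half _ _ i sz' sz (esym qz).
    by move=> h1 h2; apply/andP; split; lra.
  rewrite sumr_const card_ord -[leLHS]mulr_natl /t mulrCA ler_piMr ?ltW//.
  by rewrite ltr_pdivrMr// mul1r ltr_nat.
have [X XP] : {X : {ffun 'I_d * 'I_M -> bool} -> d.-tuple R & forall v,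
    enorm (X v) <= 1 /\ (forall z, supported z -> q z = v -> enorm (subv (signed_input z) (X v)) <= tau)}.
  apply: (@choice _ _ (fun v x => enorm x <= 1 /\
    (forall z, supported z -> q z = v -> enorm (subv (signed_input z) x) <= tau))) => v.
  have [[z0 sz0 qz0]|nz] := pselect (exists2 z, supported z & q z = v).
    exists (signed_input z0); split; first exact: enorm_signed_input.
    by move=> z sz qz; apply: close => //; rewrite qz qz0.
  exists (zerov R d); split; first by rewrite enorm0.
  by move=> z sz qz; exfalso; apply: nz; exists z.
exists _, q, X; split=> // [v|z sz]; first exact: (XP v).1.
exact: (XP _).2.
Qed.

End Quantizer.

(** * Analytic consequences of admissibility *)

Section Loss.
Context {R : realType} (c1 : R) (L : R -> R).
Hypothesis L_adm : admissible_loss c1 L.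

Lemma admissible_loss_bound_ge0 : 0 <= c1.
Proof. by case: L_adm => _ [_ _ _ _ h]; exact: le_trans (normr_ge0 _) (h 0). Qed.

Lemma admissible_loss_convex (t u v : R) : 0 <= t <= 1 ->
  L (t * u + (1 - t) * v) <= t * L u + (1 - t) * L v.
Proof.
case: L_adm => conv _ /andP[t0 t1].
have [->|uv] := eqVneq u v; first by rewrite -!mulrDl !(addrC t) !subrK !mul1r.
have [->|tn0] := eqVneq t 0; first by rewrite !mul0r !add0r subr0 !mul1r.
have [->|tn1] := eqVneq t 1; first by rewrite subrr !mul0r !addr0 !mul1r.
by apply/ltW/conv => //; rewrite lt_neqAle ?t0 ?t1 ?andbT// eq_sym.
Qed.

Lemma admissible_loss_lipschitz (u v : R) : `|L u - L v| <= `|u - v|.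
Proof.
wlog uv : u v / v <= u.
  move=> h; have [/h//|/ltW uv] := leP v u.
  by rewrite distrC [leRHS]distrC; exact: h.
case: L_adm => _ [dL _ _ L1 _].
have cL : {within `[v, u], continuous L}.
  by apply: continuous_subspaceT => x; apply/differentiable_continuous/derivable1_diffP.
have dL' x : x \in `]v, u[ -> is_derive x 1 L (derive1 L x).
  by move=> _; rewrite derive1E; apply: DeriveDef.
have [x _ ->] := MVT_segment uv dL' cL.
by rewrite normrM ler_piMl.
Qed.

Lemma admissible_loss_measurable : measurable_fun setT L.
Proof.
case: L_adm => _ [dL _ _ _ _].
by apply: continuous_measurable_fun => x; apply/differentiable_continuous/derivable1_diffP.
Qed.

End Loss.

(** * Law of the quantized sample *)

Section Probability.
Context {R : realType} {dO : measure_display} {Omega : measurableType dO}.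
Variable P : probability Omega R.

Lemma le_probability_bigsetU (I : Type) (s : seq I) (p : pred I) (F : I -> set Omega) :
  (forall i, measurable (F i)) ->
  (P (\big[setU/set0]_(i <- s | p i) F i) <= \sum_(i <- s | p i) P (F i))%E.
Proof.
move=> mF; elim: s => [|i s IH]; first by rewrite !big_nil measure0.
rewrite !big_cons; case: ifP => // _.
apply: le_trans (leeD2l _ IH); apply: measureU2 => //.
exact: bigsetU_measurable.
Qed.

Context {d' : measure_display} {T : measurableType d'} (mu : probability T R).
Context {Q : finType} (q : T -> Q) {B : nat} (S : 'I_B -> Omega -> T).
Hypothesis mq : forall v, measurable (q @^-1` [set v]).
Hypothesis mS : forall j, measurable_fun setT (S j).
Hypothesis lawS : forall j A, measurable A -> P (S j @^-1` A) = mu A.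
Hypothesis indS : forall A : 'I_B -> set T, (forall j, measurable (A j)) ->
  P (\bigcap_(j in [set: 'I_B]) (S j @^-1` A j)) = (\prod_(j < B) P (S j @^-1` A j))%E.

Definition quantized (w : Omega) : {ffun 'I_B -> Q} := [ffun j => q (S j w)].

Let cylE v : quantized @^-1` [set v] =
  \bigcap_(j in [set: 'I_B]) (S j @^-1` (q @^-1` [set v j])).
Proof.
apply/seteqP; split=> w /=; first by move=> <- j _ /=; rewrite ffunE.
by move=> H; apply/ffunP => j; rewrite ffunE; exact: H.
Qed.

Lemma measurable_quantized v : measurable (quantized @^-1` [set v]).
Proof.
rewrite cylE; apply: fin_bigcap_measurable => // j _.
by rewrite -[X in measurable X]setTI; apply: mS.
Qed.

Lemma quantized_predE (b : pred {ffun 'I_B -> Q}) :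
  [set w | b (quantized w)] = \big[setU/set0]_(v | b v) (quantized @^-1` [set v]).
Proof.
rewrite -bigcup_seq_cond; apply/seteqP; split=> w /=.
  by move=> bw; exists (quantized w) => //=; rewrite mem_index_enum.
by move=> [v /= /andP[_ bv] ->].
Qed.

Lemma measurable_quantized_pred (b : pred {ffun 'I_B -> Q}) :
  measurable [set w | b (quantized w)].
Proof.
by rewrite quantized_predE; apply: bigsetU_measurable => v _; exact: measurable_quantized.
Qed.

Lemma quantized_pred_le (b : pred {ffun 'I_B -> Q}) :
  (P [set w | b (quantized w)] <= (\sum_(v | b v) \prod_j cell_mass mu q (v j))%:E)%E.
Proof.
rewrite quantized_predE.
apply: le_trans (le_probability_bigsetU _ _ measurable_quantized) _.
rewrite -sumEFin; apply: lee_sum => v _; rewrite cylE indS//.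
rewrite -prodEFin le_eqVlt; apply/orP; left; apply/eqP.
by apply: eq_bigr => j _; rewrite lawS// -cell_massE.
Qed.

End Probability.

(** * Deterministic excess risk bound on the good event *)

Section ExcessRisk.
Context {R : realType} {d : nat} {Q : finType} {B : nat}.
Context (CR rho tau r kap nu : R) (L : R -> R) (p : Q -> R) (X : Q -> d.-tuple R).
Hypotheses (CR0 : 0 < CR) (rho0 : 0 < rho) (tau0 : 0 <= tau) (r0 : 0 < r) (B0 : (0 < B)%N).
Hypothesis L_convex : forall t u v, 0 <= t <= 1 ->
  L (t * u + (1 - t) * v) <= t * L u + (1 - t) * L v.
Hypothesis L_lip : forall u v, `|L u - L v| <= `|u - v|.
Hypothesis p_ge0 : forall v, 0 <= p v.
Hypothesis p_sum : \sum_v p v = 1.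
Hypothesis X_le1 : forall v, enorm (X v) <= 1.

Definition cell_objective : d.-tuple R -> R :=
  objective (fun v => CR * p v) X L rho (zerov R d).

Lemma cell_weight_ge0 v : 0 <= CR * p v.
Proof. by rewrite mulr_ge0// ltW. Qed.

(** Uniform in the quantization, so [tau] can be fixed before [c] exists. *)
Lemma cell_argmin_enorm c : is_argmin cell_objective c -> enorm c <= 2 * CR / rho.
Proof.
move=> /(argmin_enorm cell_weight_ge0 L_lip rho0) /le_trans; apply.
rewrite ler_pM2r ?invr_gt0// ler_pM2l// enorm0 addr0.
apply: (@le_trans _ _ (\sum_v CR * p v)).
  by apply: ler_sum => v _; rewrite ler_piMr// cell_weight_ge0.
by rewrite -mulr_sumr p_sum mulr1.
Qed.

(** [s] adds up what can separate the two objectives on the ball: sampling ([kap]), noise ([nu]) and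
    quantization ([tau]). *)
Lemma erm_excess_risk (C : d.-tuple R -> R) (D : 'I_B -> (d.-tuple R * R)%type)
    (e c f0 : d.-tuple R) (v : {ffun 'I_B -> Q}) :
  let s := r * (CR * kap + nu) + CR * (2 * enorm c + r) * tau in
  s < rho * r ^+ 2 / 4 ->
  is_argmin cell_objective c ->
  (forall f, `|C f - CR * \sum_v p v * L (dotv f (X v))| <= CR * (enorm f * tau)) ->
  (forall j f, `|L ((D j).2 * dotv f (D j).1) - L (dotv f (X (v j)))| <= enorm f * tau) ->
  ~ large_deviation p X L c r kap v ->
  CR / B%:R * enorm e <= nu ->
  exists fstar, is_argmin (fun f => Zp_obj CR rho L D f + CR / B%:R * dotv e f) fstar /\
    C fstar <= C f0 + rho * regul f0 + s + CR * (enorm c + r + enorm f0) * tau.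
Proof.
move=> s sr cmin CX DX nbad enu.
have BR : 0 < B%:R :> R by rewrite ltr0n.
have CB : 0 < CR / B%:R by rewrite divr_gt0.
pose J f := Zp_obj CR rho L D f + CR / B%:R * dotv e f.
have JE : J = objective (fun _ : 'I_B => CR / B%:R) (fun j => signed_input (D j)) L rho
    (lcomb (CR / B%:R) e 0 e).
  apply/funext => f; rewrite /J /Zp_obj /objective dotv_lcomb mul0r addr0.
  congr (_ + _ + _); rewrite mulr_sumr; apply: eq_bigr => j _.
  by rewrite dotv_signed_input.
have [f fmin] : exists f, is_argmin J f by rewrite JE; apply: objective_argmin => // _; exact: ltW.
exists f; split=> //.
have cellE g : cell_objective g = CR * \sum_v p v * L (dotv g (X v)) + rho * regul g.
  rewrite /cell_objective /objective [dotv (zerov R d) g]dotvC dotv0 addr0.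
  by rewrite mulr_sumr; congr (_ + _); apply: eq_bigr => k _; rewrite mulrA.
have dev g : enorm (subv g c) <= r ->
    (cell_objective g - cell_objective c) - (J g - J c) <= s.
  move=> gr.
  have h1 : \sum_j (\sum_q p q * excess X L c g q - excess X L c g (v j)) <= B%:R * (r * kap).
    by rewrite leNgt; apply/negP => h; apply: nbad; exists g.
  have h2 : \sum_(j < B) (L ((D j).2 * dotv c (D j).1) - L ((D j).2 * dotv g (D j).1)
       + excess X L c g (v j)) <= B%:R * ((enorm g + enorm c) * tau).
    apply: (@le_trans _ _ (\sum_(j < B) (enorm g + enorm c) * tau)).
      apply: ler_sum => j _; rewrite /excess.
      have := DX j g; have := DX j c; rewrite !ler_norml => /andP[? ?] /andP[? ?]; lra.
    by rewrite sumr_const card_ord -[leLHS]mulr_natl.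
  have h3 : - dotv e (subv g c) <= enorm e * r.
    have := cauchy_schwarz e (subv g c); rewrite ler_norml => /andP[h _].
    have := ler_wpM2l (enorm_ge0 e) gr; lra.
  have gc : enorm g <= enorm c + r by apply: le_trans (enorm_subv g c) _; rewrite lerD2l.
  have exE : \sum_v p v * L (dotv g (X v)) - \sum_v p v * L (dotv c (X v)) =
      \sum_q p q * excess X L c g q.
    by rewrite -sumrB; apply: eq_bigr => k _; rewrite mulrBr.
  have E : (cell_objective g - cell_objective c) - (J g - J c) =
      CR / B%:R * (\sum_j (\sum_q p q * excess X L c g q - excess X L c g (v j)) +
        \sum_(j < B) (L ((D j).2 * dotv c (D j).1) - L ((D j).2 * dotv g (D j).1)
       + excess X L c g (v j))) + CR / B%:R * (- dotv e (subv g c)).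
    rewrite sumrB sumr_const card_ord -[(\sum_q _) *+ B]mulr_natl.
    rewrite [X in _ * (_ + X)]big_split/= [X in _ * (_ + (X + _))]sumrB !cellE /J /Zp_obj dotv_lcombr -exE.
    by field; rewrite gt_eqF.
  rewrite E.
  have k1 := ler_wpM2l (ltW CB) (lerD h1 h2).
  have k2 := ler_wpM2l (ltW CB) h3.
  have k3 : CR / B%:R * (enorm e * r) <= nu * r by rewrite mulrA ler_wpM2r// ltW.
  have k4 : CR / B%:R * (B%:R * (r * kap) + B%:R * ((enorm g + enorm c) * tau)) =
      CR * (r * kap) + CR * ((enorm g + enorm c) * tau) by field; rewrite gt_eqF.
  have k5 : CR * ((enorm g + enorm c) * tau) <= CR * ((2 * enorm c + r) * tau).
    by rewrite ler_wpM2l ?(ltW CR0)// ler_wpM2r//; lra.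
  rewrite /s; lra.
have Gconv g h : cell_objective (midpoint g h) <=
    2^-1 * cell_objective g + 2^-1 * cell_objective h - rho / 8 * enorm (subv g h) ^+ 2.
  exact: objective_midpoint cell_weight_ge0 L_convex _ _.
have Jconv t g h : 0 <= t <= 1 -> J (lcomb t g (1 - t) h) <= t * J g + (1 - t) * J h.
  by rewrite JE; apply: objective_convex => // _; exact: ltW.
have [fr fG] := argmin_localized r0 rho0 sr Jconv Gconv cmin fmin dev.
have fc : enorm f <= enorm c + r by apply: le_trans (enorm_subv f c) _; rewrite lerD2l.
(* The comparison with [f0] passes through [c], which has the smaller quantized objective; the
   regularizer of [f] is dropped, that of [f0] stays. *)
have := cmin f0; rewrite !cellE in fG * => cf0.
have rf0 : 0 <= rho * regul f.
  by apply: mulr_ge0; [exact: ltW|apply: mulr_ge0 => //; exact: sqr_ge0].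
have := CX f; have := CX f0; rewrite !ler_norml => /andP[a1 a2] /andP[b1 b2].
have : CR * (enorm f * tau) <= CR * ((enorm c + r) * tau).
  by rewrite ler_wpM2l ?(ltW CR0)// ler_wpM2r.
lra.
Qed.

End ExcessRisk.

(** * Logarithmic estimates *)

Section Numerics.
Context {R : realType}.

Lemma ln_le_subr1 (x : R) : 0 < x -> ln x <= x - 1.
Proof. by move=> x0; have := expR_ge1Dx (ln x); rewrite lnK ?posrE//; lra. Qed.

Lemma ln_inv_ge_half (delta : R) : 0 < delta -> delta < 2^-1 -> 2^-1 <= ln delta^-1.
Proof. by move=> d0 d1; rewrite lnV ?posrE//; have := ln_le_subr1 d0; lra. Qed.

(** Since ln 2 <= ln (d / delta), half of the exponent pays for 2 ^ d and the other half leaves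
    [delta]. *)
Lemma noise_tail_level (d : nat) (delta a t : R) : (0 < d)%N -> 0 < delta -> delta < 2^-1 ->
  2 * (d%:R * ln (d%:R / delta)) <= a / 2 * t ->
  expR (- (a / 2 * t)) * 2 ^+ d <= delta.
Proof.
move=> dgt0 delta0 delta1 h.
have d1 : 1 <= d%:R :> R by rewrite ler1n.
have l2 : ln 2 <= ln delta^-1.
  rewrite ler_ln ?posrE ?invr_gt0//.
  by rewrite -[2]invrK lef_pV2 ?posrE// ?invr_gt0// ltW.
have lp := ln_inv_ge_half delta0 delta1.
have ld : ln delta^-1 <= ln (d%:R / delta).
  rewrite ler_ln ?posrE ?invr_gt0 ?divr_gt0 ?ltr0n// ler_peMl// invr_ge0 ltW//.
have -> : 2 ^+ d = expR (d%:R * ln 2) :> R by rewrite expRM_natl lnK ?posrE.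
rewrite -expRD -[leRHS]lnK ?posrE// ler_expR.
rewrite lnV ?posrE// in l2 lp ld; nra.
Qed.

End Numerics.

Unset Implicit Arguments. Set Strict Implicit. Set Printing Implicit Defensive.

Theorem theorem4 (R : realType) (CR c1 eta : R) (Np : nat) :
  0 < CR -> 0 < eta -> (1 <= Np)%N ->
  exists beta : R, 0 < beta /\
  forall (d : nat) (L : R -> R) (Pxy : probability (d.-tuple R * R)%type R)
         (f0 : d.-tuple R) (aacc alpha delta : R) (B : nat),
    admissible_loss c1 L ->
    (* Pxy is supported on {||x|| <= 1} x {-1, 1} *)
    Pxy [set z | enorm z.1 <= 1 /\ (z.2 = 1 \/ z.2 = -1)] = 1%E ->
    f0 != zerov R d ->
    0 < aacc -> aacc <= 1 -> 0 < alpha -> alpha <= 1 ->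
    0 < delta -> delta < 2^-1 ->
    let rho := aacc / enorm f0 ^+ 2 in
    let ahat := alpha - 2 * ln (1 + c1 * CR / (B%:R * (rho + 2 * eta * Np%:R))) in
    B%:R > beta * Num.max (enorm f0 * d%:R * ln (d%:R / delta) / (aacc * alpha))
                  (Num.max (CR * c1 * enorm f0 ^+ 2 / (aacc * alpha))
                           (CR * enorm f0 ^+ 2 * ln (delta^-1) / aacc ^+ 2)) ->
    0 < ahat /\
    forall (dO : measure_display) (Omega : measurableType dO)
           (P : probability Omega R)
           (S : 'I_B -> Omega -> (d.-tuple R * R)%type)
           (eps : Omega -> d.-tuple R),
      (* the samples and the noise are random variables *)
      (forall j, measurable_fun setT (S j)) ->
      measurable_fun setT eps ->
      (* each sample has law Pxy *)
      (forall j A, measurable A -> P (S j @^-1` A) = Pxy A) ->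
      (* eps has density proportional to exp(-(ahat/2) ||e||) on R^d *)
      (forall E : set (d.-tuple R), measurable E ->
         (P (eps @^-1` E) *
            lebint_vec (fun e : d.-tuple R => (expR (- (ahat / 2) * enorm e))%:E))%E
         = lebint_vec (fun e : d.-tuple R => (\1_E e)%:E * (expR (- (ahat / 2) * enorm e))%:E)%E) ->
      (* S_0, ..., S_{B-1}, eps are mutually independent *)
      (forall (A : 'I_B -> set (d.-tuple R * R)%type) (E : set (d.-tuple R)),
         (forall j, measurable (A j)) -> measurable E ->
         P ((\bigcap_(j in [set: 'I_B]) (S j @^-1` A j)) `&` (eps @^-1` E))
         = (\prod_(j < B) P (S j @^-1` A j) * P (eps @^-1` E))%E) ->
      (* P( Chat(f*_p) <= Chat(f0) + aacc ) >= 1 - 2 delta *)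
      exists Ev : set Omega,
        [/\ measurable Ev,
            Ev `<=` [set w | exists fstar : d.-tuple R,
                       is_argmin (fun f : d.-tuple R => Zp_obj CR rho L (fun j => S j w) f
                                           + CR / B%:R * dotv (eps w) f) fstar
                       /\ Chat CR L Pxy fstar <= Chat CR L Pxy f0 + aacc]
          & ((1 - 2 * delta)%:E <= P Ev)%E].
Proof.
(* 32^3 = 128 * 256, with 256 from the square of [kap] and 128 from the deviation exponent; the
   factor [CR] supplies the second power of [CR] that the third term lacks. The summand 4 bounds the
   logarithm's argument by 1 + alpha / 4, giving ahat >= alpha / 2. *)
move=> CR0 eta0 Np1; exists (32 * 32 * 32 * CR + 4); split; first by lra.
move=> d L Pxy f0 aacc alpha delta B adm supp f0n0 aacc0 aacc1 alpha0 alpha1 delta0 delta1 rho ahat.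
set beta := 32 * 32 * 32 * CR + 4; set m1 := enorm f0 * _ * _ / _; set m2 := CR * c1 * _ / _.
set m3 := CR * _ * _ / _ => hB.
have beta0 : 0 < beta by rewrite /beta; lra.
have F0 : 0 < enorm f0 := enorm_gt0 f0n0.
have hB' m : m <= Num.max m1 (Num.max m2 m3) -> beta * m < B%:R.
  by move=> mm; apply: le_lt_trans hB; rewrite ler_pM2l.
have hB1 : beta * m1 < B%:R by apply: hB'; rewrite le_max lexx.
have hB2 : beta * m2 < B%:R by apply: hB'; rewrite !le_max lexx orbT.
have hB3 : beta * m3 < B%:R by apply: hB'; rewrite !le_max lexx !orbT.
clear hB hB'.
have l0 := ln_inv_ge_half delta0 delta1.
have m30 : 0 < m3 by rewrite /m3 divr_gt0 ?mulr_gt0 ?exprn_gt0//; lra.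
have BR : 0 < B%:R :> R by apply: lt_trans hB3; rewrite mulr_gt0.
have B0 : (0 < B)%N by rewrite -(ltr0n R).
have c10 := admissible_loss_bound_ge0 adm.
have rho0 : 0 < rho by rewrite /rho divr_gt0// exprn_gt0.
have d0 : (0 < d)%N.
  rewrite lt0n; apply: contra f0n0 => /eqP d0; apply/eqP; clear -d0.
  by apply: eq_from_tnth => i; have := ltn_ord i; rewrite {2}d0.
have ahat2 : alpha / 2 <= ahat.
  set x := c1 * CR / _ in ahat *.
  have np0 : 0 <= 2 * eta * Np%:R by rewrite !mulr_ge0// ltW.
  have den0 : 0 < rho + 2 * eta * Np%:R by lra.
  have cC : 0 <= c1 * CR by rewrite mulr_ge0// ltW.
  have x0 : 0 <= x by rewrite divr_ge0// ltW// mulr_gt0.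
  have xb : x <= alpha / 4.
    apply: (@le_trans _ _ (c1 * CR / (B%:R * rho))).
      rewrite /x ler_wpM2l// lef_pV2 ?posrE; first by rewrite ler_pM2l// lerDl.
        exact: mulr_gt0.
      exact: mulr_gt0.
    rewrite ler_pdivrMr; last exact: mulr_gt0.
    have m20 : 0 <= m2.
      rewrite /m2; apply: divr_ge0; last by rewrite ltW// mulr_gt0.
      by apply: mulr_ge0; [rewrite mulrC|exact: sqr_ge0].
    have e : m2 * (alpha * rho) = c1 * CR.
      by rewrite /m2 /rho; field; rewrite !gt_eqF.
    have : beta * m2 * (alpha * rho) <= B%:R * (alpha * rho).
      by rewrite ler_pM2r ?ltW//; exact: mulr_gt0.
    have : 4 * (m2 * (alpha * rho)) <= beta * (m2 * (alpha * rho)).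
      by rewrite ler_wpM2r ?e// /beta; lra.
    by rewrite -e; lra.
  have x1 : 0 < 1 + x by lra.
  have := ln_le_subr1 x1 => lnx.
  rewrite /ahat; lra.
have ahat0 : 0 < ahat by lra.
split=> // dO Omega P S eps mS meps lawS densE indS.
(* [Rm] dominates both 2 |c| + |f0| and |c| + 2 |f0|, so each quantization error is at most aacc /
   16. *)
pose Rm := 2 * (2 * CR / rho) + 2 * (enorm f0).
have Rm0 : 0 < Rm by have : 0 < 2 * CR / rho; [apply: divr_gt0 => //; exact: mulr_gt0|rewrite /Rm; lra].
pose tau := aacc / (16 * CR * Rm).
have tau0 : 0 < tau by apply: divr_gt0 => //; do 2 apply: mulr_gt0 => //.
(* At radius |f0|, [kap] and [nu] contribute aacc / 16 each. *)
pose kap := aacc / (16 * CR * (enorm f0)).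
have kap0 : 0 < kap by apply: divr_gt0 => //; do 2 apply: mulr_gt0 => //.
pose nu := aacc / (16 * (enorm f0)).
have Lconv := admissible_loss_convex adm.
have Llip := admissible_loss_lipschitz adm.
have [Q [q [X [mq X1 Xq]]]] := @quantizer_exists _ d _ tau0.
pose p := cell_mass Pxy q.
have p0 v : 0 <= p v := cell_mass_ge0 Pxy q v.
have p1 : \sum_v p v = 1 := cell_mass_sum Pxy mq.
have [c cmin] : exists c, is_argmin (cell_objective CR rho L p X) c.
  by apply: objective_argmin => // v; exact: cell_weight_ge0.
have cR := cell_argmin_enorm CR0 rho0 Llip p0 p1 X1 cmin.
pose bad (v : {ffun 'I_B -> Q}) : bool := `[< large_deviation p X L c (enorm f0) kap v >].
(* The Chernoff exponent is ahat t / 4 >= alpha t / 8, twice d ln (d / delta) for this [t]. *)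
pose t := 16 * (d%:R * ln (d%:R / delta)) / alpha.
have lossX f z : supported z -> `|L (z.2 * dotv f z.1) - L (dotv f (X (q z)))| <= enorm f * tau.
  move=> sz; rewrite -dotv_signed_input; apply: le_trans (Llip _ _) _.
  have -> : dotv f (signed_input z) - dotv f (X (q z)) = dotv f (subv (signed_input z) (X (q z))).
    by rewrite [RHS]dotv_lcombr; ring.
  by apply: le_trans (cauchy_schwarz _ _) _; rewrite ler_wpM2l ?enorm_ge0// Xq.
have CX f : `|Chat CR L Pxy f - CR * \sum_v p v * L (dotv f (X v))| <= CR * (enorm f * tau).
  rewrite /Chat -mulrBr normrM gtr0_norm// ler_pM2l//.
  apply: (integral_near_factor mq (h := fun z => L (z.2 * dotv f z.1))
    (k := fun v => L (dotv f (X v))) _ (measurable_supported (d := d)) supp).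
  - apply: (measurableT_comp (admissible_loss_measurable adm)).
    apply: measurable_funM; first exact: measurable_snd.
    exact: (measurableT_comp (measurable_dotvr f) measurable_fst).
  - by rewrite mulr_ge0 ?enorm_ge0// ltW.
  - by move=> z; exact: lossX.
have Bk : 128 * ln delta^-1 <= B%:R * kap ^+ 2.
  have e : m3 * kap ^+ 2 = ln delta^-1 / (256 * CR).
    by rewrite /m3 /kap; field; rewrite !gt_eqF.
  have : beta * m3 * kap ^+ 2 <= B%:R * kap ^+ 2 by rewrite ler_pM2r ?exprn_gt0// ltW.
  apply: le_trans; rewrite -mulrA e mulrA ler_pdivlMr ?mulr_gt0//.
  rewrite /beta; nra.
have ld0 : 0 <= ln (d%:R / delta).
  have : ln delta^-1 <= ln (d%:R / delta); last lra.
  rewrite ler_ln ?posrE ?invr_gt0 ?divr_gt0 ?ltr0n// ler_peMl ?ler1n//.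
  by rewrite invr_ge0 ltW.
have t0 : 0 <= t.
  by rewrite /t divr_ge0 ?mulr_ge0 ?(ltW alpha0).
have tnu : CR / B%:R * t <= nu.
  have e : CR * t = 16 * CR * aacc * m1 / (enorm f0).
    by rewrite /t /m1; field; rewrite !gt_eqF.
  have m10 : 0 <= m1.
    by rewrite /m1 divr_ge0 ?mulr_ge0 ?(ltW alpha0) ?(ltW F0) ?(ltW aacc0).
  rewrite mulrAC ler_pdivrMr// e /nu.
  have -> : aacc / (16 * (enorm f0)) * B%:R = (aacc * B%:R / 16) / (enorm f0) by field; rewrite gt_eqF.
  rewrite ler_pM2r ?invr_gt0//.
  have : aacc * (beta * m1) <= aacc * B%:R by rewrite ler_pM2l// ltW.
  have : aacc * (CR * m1) * 256 <= aacc * (beta * m1).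
    have : 0 <= aacc * m1 by rewrite mulr_ge0// ltW.
    rewrite /beta; nra.
  lra.
pose E1 : set Omega := eps @^-1` [set e | t < enorm e].
pose E2 : set Omega := \big[setU/set0]_(j < B) (S j @^-1` ~` supported).
pose E3 : set Omega := [set w | bad (quantized q S w)].
have mTail : measurable [set e : d.-tuple R | t < enorm e].
  rewrite -[X in measurable X]setTI.
  have me : measurable_fun setT (@enorm R d) := measurable_enorm.
  have := me measurableT _ (measurable_itv `]t, +oo[).
  by congr measurable; apply/seteqP; split=> e /=; rewrite in_itv/= andbT.
have mE1 : measurable E1 by rewrite -[X in measurable X]setTI; exact: meps.
have mSs j : measurable (S j @^-1` ~` supported).
  by rewrite -[X in measurable X]setTI; apply: mS => //; apply: measurableC; exact: measurable_supported.
have mE2 : measurable E2 by exact: bigsetU_measurable.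
have mE3 : measurable E3 by exact: measurable_quantized_pred.
have PE1 : (P E1 <= delta%:E)%E.
  have a0 : 0 < ahat / 2 by lra.
  have [Z Z0 ZE] := noise_weight_fin (d := d) a0.
  have := noise_tail (d := d) a0 t0.
  rewrite -[leLHS]densE// -/(noise_weight (d := d) (ahat / 2)) ZE -(fineK (fin_num_measure P E1 mE1)).
  rewrite -!EFinM !lee_fin ler_pM2r// => /le_trans; apply.
  apply: noise_tail_level => //; rewrite /t.
  have : 0 <= d%:R * ln (d%:R / delta) by rewrite mulr_ge0.
  set y := d%:R * _ => y0.
  rewrite [leRHS]mulrA ler_pdivlMr//; nra.
have PE2 : (P E2 <= 0)%E.
  apply: le_trans (le_probability_bigsetU _ _ _ mSs) _.
  rewrite big1 // => j _; rewrite lawS; last by apply: measurableC; exact: measurable_supported.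
  by rewrite probability_setC ?supp ?subee//; exact: measurable_supported.
have indS' (A : 'I_B -> set (d.-tuple R * R)%type) : (forall j, measurable (A j)) ->
    P (\bigcap_(j in [set: 'I_B]) (S j @^-1` A j)) = (\prod_(j < B) P (S j @^-1` A j))%E.
  move=> mA; have := indS A setT mA measurableT.
  by rewrite preimage_setT setIT probability_setT mule1.
have PE3 : (P E3 <= delta%:E)%E.
  apply: le_trans (quantized_pred_le mq mS lawS indS' bad) _; rewrite lee_fin.
  (* ln (1 / delta) >= 1/2, so [Bk] also gives the required lower bound 16. *)
  apply: le_trans (large_deviation_le c p0 p1 X1 Llip F0 kap0 _) _; first lra.
  rewrite -[leRHS]lnK ?posrE// ler_expR; rewrite lnV ?posrE// in Bk; lra.
(* The good event is a measurable subset of the target; [E2], where some sample leaves the support,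
   is null, so only [E1] and [E3] cost [delta] each. *)
exists (~` (E1 `|` (E2 `|` E3))); split.
- by apply: measurableC; do 2 apply: measurableU => //.
- move=> w /= nE.
  have n1 : enorm (eps w) <= t by rewrite leNgt; apply/negP => h; apply: nE; left.
  have n2 j : supported (S j w).
    apply: contrapT => h; apply: nE; right; left.
    by rewrite /E2 -bigcup_seq; exists j => //=; rewrite mem_index_enum.
  have n3 : ~ large_deviation p X L c (enorm f0) kap (quantized q S w).
    by move=> h; apply: nE; right; right; apply/asboolP.
  have rk : (enorm f0) * (CR * kap + nu) = aacc / 8.
    by rewrite /kap /nu; field; rewrite !gt_eqF.
  have rt : CR * Rm * tau = aacc / 16.
    by rewrite /tau; field; rewrite !gt_eqF.
  have rF : rho * enorm f0 ^+ 2 = aacc by rewrite /rho divfK// gt_eqF// exprn_gt0.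
  have t1 : CR * (2 * enorm c + (enorm f0)) * tau <= CR * Rm * tau.
    by rewrite ler_pM2r// ler_pM2l// /Rm; lra.
  have t2 : CR * (enorm c + (enorm f0) + (enorm f0)) * tau <= CR * Rm * tau.
    by rewrite ler_pM2r// ler_pM2l// /Rm; have := enorm_ge0 c; lra.
  have sr : enorm f0 * (CR * kap + nu) + CR * (2 * enorm c + enorm f0) * tau <
      rho * enorm f0 ^+ 2 / 4 by rewrite rk rF; lra.
  have DX j f : `|L ((S j w).2 * dotv f (S j w).1) - L (dotv f (X (quantized q S w j)))| <=
      enorm f * tau by rewrite ffunE; exact: lossX.
  have enu : CR / B%:R * enorm (eps w) <= nu.
    by apply: le_trans tnu; rewrite ler_pM2l// divr_gt0.
  have [fs [fs1 fs2]] := erm_excess_risk CR0 rho0 (ltW tau0) F0 B0 Lconv Llip p0 f0 sr cmin CX DX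
    n3 enu.
  exists fs; split=> //; apply: le_trans fs2 _; rewrite rk /regul; lra.
- have mU : measurable (E1 `|` (E2 `|` E3)) by do 2 apply: measurableU => //.
  have PU : (P (E1 `|` (E2 `|` E3)) <= (2 * delta)%:E)%E.
    have U1 := measureU2 P mE1 (measurableU _ _ mE2 mE3).
    have U2 := measureU2 P mE2 mE3.
    apply: le_trans U1 _; rewrite mulr_natl mulr2n EFinD; apply: leeD => //.
    by apply: le_trans U2 _; rewrite -[leRHS]add0e; apply: leeD.
  by rewrite probability_setC// EFinB; apply: leeB.
Qed.
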